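(* Let $A\in\mathbb{R}^{m\times m}$, let $\sigma\in\mathbb{R}^{m\times n}$ satisfy $\sigma\sigma^*=I_m$, let $b\in\mathbb{R}^n$, and let $L_t=B_t+bt$, where $B$ is a standard Brownian motion in $\mathbb{R}^n$. For $x\in\mathbb{R}^m$ let $(X_t(x))_{t\ge 0}$ be the solution of $\mathrm{d}X_t(x)=-AX_t(x)\,\mathrm{d}t+\sigma\,\mathrm{d}L_t$, $X_0(x)=x$. Whenever all eigenvalues of $A$ have strictly positive real part, let $\mu$ be the unique invariant (limiting) distribution of this equation, that is, $\mu=\mathcal{N}(A^{-1}\sigma b,\Sigma_\infty)$ with $\Sigma_\infty=\int_0^\infty e^{-As}\sigma\sigma^*e^{-A^*s}\,\mathrm{d}s$. (1) If $A$ is a positive definite symmetric matrix with eigenvalues $0<\lambda_1\le\lambda_2\le\cdots\le\lambda_m$ and corresponding orthonormal eigenvectors $v_1,\ldots,v_m$, then for all $x\in\mathbb{R}^m$ and $t\ge 0$ $$\mathcal{W}_2(X_t(x),\mu)=\left(\sum_{j=1}^{m} e^{-2\lambda_j t}\langle x-A^{-1}\sigma b,v_j\rangle^2+\sum_{j=1}^{m}\frac{1}{2\lambda_j}\frac{e^{-4\lambda_j t}}{(\sqrt{1-e^{-2\lambda_j t}}+1)^2}\right)^{1/2}.$$ (2) If $A$ is a normal matrix, that is, $AA^*=A^*A$, and $A+A^*$ has eigenvalues $0<\varphi_1\le\varphi_2\le\cdots\le\varphi_m$ with corresponding orthonormal eigenvectors $v_1,\ldots,v_m\in\mathbb{R}^m$,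 then for all $x\in\mathbb{R}^m$ and $t\ge 0$ $$\mathcal{W}_2(X_t(x),\mu)=\left(\sum_{j=1}^{m} e^{-\varphi_j t}\langle x-A^{-1}\sigma b,v_j\rangle^2+\sum_{j=1}^m \frac{1}{\varphi_j}\frac{e^{-2\varphi_j t}}{(\sqrt{1-e^{-\varphi_j t}}+1)^2}\right)^{1/2},$$ where $\varphi_j=2\,\mathrm{Re}(\lambda_j)$, $j=1,\ldots,m$, and $\lambda_1,\ldots,\lambda_m$ are the eigenvalues of $A$ ordered ascendingly by their real parts.
   Context: $\mathcal{W}_2(\mu_1,\mu_2)=\big(\inf_{\mathcal{T}}\int_{\mathbb{R}^m\times\mathbb{R}^m}|u-v|^2\,\mathcal{T}(\mathrm{d}u,\mathrm{d}v)\big)^{1/2}$, where the infimum is over all couplings $\mathcal{T}$ of $\mu_1$ and $\mu_2$ (joint distributions with these marginals); a random vector used as an argument of $\mathcal{W}_2$ stands for its law. $|\cdot|$ and $\langle\cdot,\cdot\rangle$ are the Euclidean norm and inner product, $M^*$ is the (conjugate) transpose, $I_m$ is the identity matrix, and $\mathcal{N}(a,C)$ is the normal distribution with mean $a$ and covariance matrix $C$. The solution is $X_t(x)=e^{-At}x+\int_0^t e^{-A(t-s)}\sigma\,\mathrm{d}L_s$. *)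

(* Defs.v *)
From HB Require Import structures.
From mathcomp Require Import all_boot all_order all_algebra.
From mathcomp Require Import complex.
From mathcomp Require Import all_classical all_reals all_analysis.

Set Implicit Arguments.
Unset Strict Implicit.
Unset Printing Implicit Defensive.

Import Order.TTheory GRing.Theory Num.Theory.
Import numFieldNormedType.Exports.

Local Open Scope classical_set_scope.
Local Open Scope ring_scope.

(* R^m is the type 'cV[R]_m with the sigma-algebra generated by the
   coordinates, i.e. the Borel sigma-algebra; same construction as for tuples
   in the library. *)
Definition measure_cV_display : measure_display -> measure_display.
Proof. exact. Qed.

Section measurable_cV.
Context {d : measure_display} {T : sigmaRingType d}.
Variable n : nat.

Let coors : 'I_n -> 'cV[T]_n -> T := fun i x => x i ord0.

Let cV_set0 : g_sigma_preimage coors set0.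
Proof. exact: sigma_algebra0. Qed.

Let cV_setC A : g_sigma_preimage coors A -> g_sigma_preimage coors (~` A).
Proof. exact: sigma_algebraC. Qed.

Let cV_bigcup (F : _^nat) : (forall i, g_sigma_preimage coors (F i)) ->
  g_sigma_preimage coors (\bigcup_i (F i)).
Proof. exact: sigma_algebra_bigcup. Qed.

HB.instance Definition _ := @isMeasurable.Build (measure_cV_display d)
  'cV[T]_n (g_sigma_preimage coors) cV_set0 cV_setC cV_bigcup.

End measurable_cV.

Definition dotcV (R : realType) (m : nat) (u v : 'cV[R]_m) : R :=
  \sum_(i < m) u i ord0 * v i ord0.

(* The library norm on matrices is the sup norm. *)
Definition enorm (R : realType) (m : nat) (u : 'cV[R]_m) : R :=
  Num.sqrt (dotcV u u).

Definition orthonormal_family (R : realType) (m k : nat)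
    (v : 'I_k -> 'cV[R]_m) : Prop :=
  forall i j, dotcV (v i) (v j) = (i == j)%:R.

Definition posdefmx (R : realType) (m : nat) (A : 'M[R]_m) : Prop :=
  forall u : 'cV[R]_m, u != 0 -> 0 < dotcV u (A *m u).

Definition expmx (R : realType) (m : nat) (A : 'M[R]_m) : 'M[R]_m :=
  limn (series (fun k => k`!%:R^-1 *: A ^+ k)).

Definition coupling (R : realType) (m : nat) (mu nu : probability 'cV[R]_m R)
    (pi : probability ('cV[R]_m * 'cV[R]_m)%type R) : Prop :=
  forall E : set 'cV[R]_m, measurable E ->
    pi (fst @^-1` E) = mu E /\ pi (snd @^-1` E) = nu E.

Definition wasserstein2 (R : realType) (m : nat)
    (mu nu : probability 'cV[R]_m R) : \bar R :=
  (ereal_inf [set \int[pi]_z ((enorm (z.1 - z.2)%R ^+ 2)%R)%:E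
             | pi in [set pi | coupling mu nu pi]] `^ 2^-1)%E.

(* Mean a, variance v: normal_prob takes a standard deviation, and is a
   uniform law instead of the Dirac mass when it is zero. *)
Definition normal1 (R : realType) (a v : R) (E : set R) : \bar R :=
  if v == 0 then \d_a E else normal_prob a (Num.sqrt v) E.

(* N(a, C), possibly degenerate: every linear functional <u, .> is normally
   distributed with mean <u, a> and variance <u, C u>. *)
Definition normal_law (R : realType) (m : nat) (mu : set 'cV[R]_m -> \bar R)
    (a : 'cV[R]_m) (C : 'M[R]_m) : Prop :=
  [/\ C^T = C,
      forall u : 'cV[R]_m, 0 <= dotcV u (C *m u)
    & forall (u : 'cV[R]_m) (E : set R), measurable E ->
        mu (dotcV u @^-1` E) = normal1 (dotcV u a) (dotcV u (C *m u)) E].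

Section processes.
Context {R : realType} {d : measure_display} {Omega : measurableType d}.
Variable P : probability Omega R.

Definition mutually_independent (m k : nat) (Y : 'I_k -> Omega -> 'cV[R]_m) :
    Prop :=
  forall E : 'I_k -> set 'cV[R]_m, (forall i, measurable (E i)) ->
    P (\bigcap_i (Y i @^-1` E i)) = (\prod_(i < k) P (Y i @^-1` E i))%E.

Definition continuous_paths (m : nat) (Y : R -> Omega -> 'cV[R]_m)
    (w : Omega) : Prop :=
  {within `[0, +oo[, continuous (fun t => Y t w)}.

(* Processes are indexed by R, but only their values at times t >= 0 are
   constrained. *)
Definition brownian_motion (n : nat) (B : R -> {RV P >-> 'cV[R]_n}) : Prop :=
  [/\ {ae P, forall w, B 0 w = 0},
      {ae P, forall w, continuous_paths B w},
      forall s t : R, 0 <= s -> s <= t ->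
        normal_law (pushforward P (fun w => B t w - B s w)) 0 (t - s)%:M
    & forall (k : nat) (t : nat -> R), 0 <= t 0%N ->
        {homo t : i j / (i <= j)%N >-> i <= j} ->
        mutually_independent
          (fun (i : 'I_k) w => B (t i.+1) w - B (t i) w)].

(* Solution of dX = - A X dt + sigma dL, X_0 = x. As the noise is additive,
   the equation X_t = x - int_0^t A X_s ds + sigma (L_t - L_0) is meaningful
   path by path, without a stochastic integral. *)
Definition sde_solution (m n : nat) (A : 'M[R]_m) (sigma : 'M[R]_(m, n))
    (L : R -> Omega -> 'cV[R]_n) (x : 'cV[R]_m)
    (X : R -> {RV P >-> 'cV[R]_m}) : Prop :=
  {ae P, forall w, continuous_paths X w /\
    forall t : R, 0 <= t ->
      X t w = x
        - (\col_i \int[lebesgue_measure]_(s in `[0, t]) (A *m X s w) i ord0)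
        + sigma *m (L t w - L 0 w)}.

End processes.

Definition stationary_cov (R : realType) (m n : nat) (A : 'M[R]_m)
    (sigma : 'M[R]_(m, n)) : 'M[R]_m :=
  \matrix_(i, j) \int[lebesgue_measure]_(s in `[0, +oo[)
    (expmx (- s *: A) *m sigma *m sigma^T *m expmx (- s *: A^T)) i j.

Definition cplxmx (R : realType) (m : nat) (A : 'M[R]_m) : 'M[R[i]]_m :=
  map_mx (real_complex R) A.

(* The family l lists the complex eigenvalues of A, repeated according to
   algebraic multiplicity. *)
Definition eigenvalues_of (R : realType) (m : nat) (A : 'M[R]_m)
    (l : 'I_m -> R[i]) : Prop :=
  char_poly (cplxmx A) = \prod_(j < m) ('X - (l j)%:P).

(* Main.v *)
Require Import Defs.
From HB Require Import structures.
From mathcomp Require Import all_boot all_order all_algebra.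
From mathcomp Require Import complex spectral ring.
From mathcomp Require Import all_classical all_reals all_analysis.
From mathcomp Require Import measurable_realfun.

Set Implicit Arguments.
Unset Strict Implicit.
Unset Printing Implicit Defensive.

Import Order.TTheory GRing.Theory Num.Theory.
Import numFieldNormedType.Exports.

Local Open Scope classical_set_scope.
Local Open Scope ring_scope.

(** The law of X_t is a Gaussian whose covariance commutes with that of mu: with
    tau_j = sqrt (1 - e^{- phi_j t}) and T = sum_j tau_j v_j v_j^T, it is the image
    of mu under z |-> E X_t + T (z - A^{-1} sigma b).  This map is an optimal
    coupling; optimality only needs the means and variances of the coordinates
    along the v_j, through y^2 - y^2 / s + z^2 - s z^2 <= (y - z)^2.

    The law of X_t is identified by its characteristic function: since
    W s = e^{- (t - s) A^T} u solves W' = A^T W, summation by parts turns <u, X_t>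
    into the pathwise limit of sums of independent Brownian increments weighted
    by sigma^T W.  Two laws on R^m with the same E cos (<u, .> + c) agree because
    the closure of these functions under products and bounded limits contains the
    indicators of half-spaces, hence of all Borel sets. *)

(** Normality of A gives e^{-sA} e^{-sA^T} = e^{-s(A + A^T)}, and sigma sigma^T = I removes sigma
    from the covariances. Hence the covariance of X_t has eigenvalue (1 - e^{-phi_j t}) / phi_j
    along v_j, that of mu has 1 / phi_j, and tau_j is the square root of their ratio. The map costs
    (1 - tau_j)^2 / phi_j in direction j; the stated fraction comes from (1 - tau_j)(1 + tau_j) =
    e^{-phi_j t}. The symmetric case is the normal one with phi_j = 2 lambda_j.

    At t = 0 every tau_j vanishes and s = tau_j is not allowed in the inequality. The lower bound
    therefore takes s = tau_j + q with an arbitrarily small q > 0.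

    [normal_law] prescribes one-dimensional projections only, hence the detour through
    characteristic functions. Their closed form is never computed: v -> E cos (sqrt v N) is kept as
    it is. Besides its continuity, what matters is that it turns sums into products, and this is
    read off the Brownian motion itself. *)

Section bounded_functions.
Context {R : realType} {d : measure_display} {T : measurableType d}.
Implicit Types (f g : T -> R).

(** * Bounded measurable functions and an induction principle for them *)

Definition bounded_mfun f :=
  measurable_fun setT f /\ exists M, forall x, `|f x| <= M.

Lemma bounded_mfun_cst c : bounded_mfun (fun=> c).
Proof. by split; [exact: measurable_cst | exists `|c|]. Qed.

Lemma bounded_mfunD f g :
  bounded_mfun f -> bounded_mfun g -> bounded_mfun (fun x => f x + g x).
Proof.
move=> [mf [M fM]] [mg [N gN]]; split; first exact: measurable_funD.
by exists (M + N) => x; rewrite (le_trans (ler_normD _ _))// lerD.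
Qed.

Lemma bounded_mfunM f g :
  bounded_mfun f -> bounded_mfun g -> bounded_mfun (fun x => f x * g x).
Proof.
move=> [mf [M fM]] [mg [N gN]]; split; first exact: measurable_funM.
by exists (M * N) => x; rewrite normrM ler_pM.
Qed.

Lemma bounded_mfunZ c f : bounded_mfun f -> bounded_mfun (fun x => c * f x).
Proof. by apply: bounded_mfunM; exact: bounded_mfun_cst. Qed.

Import HBNNSimple.

Lemma bounded_mfun_indic (E : set T) : measurable E ->
  bounded_mfun (\1_E : T -> R).
Proof.
move=> mE; split; first exact: measurable_indic.
by exists 1 => x; rewrite indicE; case: (_ \in _); rewrite ?normr1 ?normr0.
Qed.

Lemma bounded_mfun_cos f : measurable_fun setT f ->
  bounded_mfun (fun x => cos (f x)).
Proof.
move=> mf; split; last by exists 1 => x; rewrite ler_norml cos_geN1 cos_le1.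
apply: measurableT_comp => //; apply: continuous_measurable_fun.
exact: continuous_cos.
Qed.

Lemma bounded_mfun_sin f : measurable_fun setT f ->
  bounded_mfun (fun x => sin (f x)).
Proof.
move=> mf; split; last by exists 1 => x; rewrite ler_norml sin_geN1 sin_le1.
apply: measurableT_comp => //; apply: continuous_measurable_fun.
exact: continuous_sin.
Qed.

Lemma bounded_mfun_prod (I : eqType) (s : seq I) (f : I -> T -> R) :
  (forall i, bounded_mfun (f i)) -> bounded_mfun (fun x => \prod_(i <- s) f i x).
Proof.
move=> bf; elim: s => [|i s IH].
  rewrite (_ : (fun _ => _) = fun=> 1); first exact: bounded_mfun_cst.
  by apply/funext => x; rewrite big_nil.
rewrite (_ : (fun _ => _) = fun x => f i x * \prod_(i <- s) f i x).
  exact: bounded_mfunM.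
by apply/funext => x; rewrite big_cons.
Qed.

Lemma cvg_bounded_mfun (f_ : nat -> T -> R) f (M : R) :
  (forall n, measurable_fun setT (f_ n)) ->
  (forall n x, `|f_ n x| <= M) -> (forall x, f_ ^~ x @ \oo --> f x) ->
  bounded_mfun f.
Proof.
move=> mf fM cf; split.
  by apply: (measurable_fun_cvg _ (fun x _ => cf x)) => //.
exists M => x; have cn : (fun n => `|f_ n x|) @ \oo --> `|f x|.
  exact: cvg_norm.
rewrite -(cvg_lim (@norm_hausdorff _ _) cn); apply: limr_le.
  by apply/cvg_ex; exists `|f x|.
by near=> n; exact: fM.
Unshelve. all: by end_near. Qed.

Lemma bounded_mfun_integrable (P : probability T R) f : bounded_mfun f ->
  P.-integrable setT (EFin \o f).
Proof.
move=> [mf [M fM]]; apply: measurable_bounded_integrable => //.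
  by rewrite (le_lt_trans (probability_le1 _ _))// ltry.
exists M; split; first exact: num_real.
by move=> y My x _ /=; rewrite (le_trans (fM x))// ltW.
Qed.

(* Boundedness is uniform along the sequence, so that dominated convergence
   applies to the closure step. *)
Import HBNNSimple.

Lemma bounded_mfun_ind (Q : (T -> R) -> Prop) :
  (forall E, measurable E -> Q \1_E) ->
  (forall c f g, bounded_mfun f -> bounded_mfun g -> Q f -> Q g ->
     Q (fun x => c * f x + g x)) ->
  (forall (f_ : nat -> T -> R) f (M : R), (forall n, bounded_mfun (f_ n)) ->
     (forall n x, `|f_ n x| <= M) -> (forall x, f_ ^~ x @ \oo --> f x) ->
     (forall n, Q (f_ n)) -> Q f) ->
  forall f, bounded_mfun f -> Q f.
Proof.
move=> Q1 QL Qlim.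
have Q0 : Q (fun=> 0).
  rewrite (_ : (fun _ => _) = \1_set0); first exact: Q1.
  by apply/funext => x; rewrite indic0.
have Qc c : Q (fun=> c).
  rewrite (_ : (fun _ => _) = fun x => c * \1_[set: T] x + 0).
    apply: (QL c (\1_[set: T]) (fun=> 0)) => //.
    - exact: bounded_mfun_indic.
    - exact: bounded_mfun_cst.
    - exact: Q1.
  by apply/funext => x; rewrite indicT/= mulr1 addr0.
have Qs (g : {nnsfun T >-> R}) : Q (g : T -> R).
  rewrite (_ : (g : T -> R) = fun x => \sum_(y <- finmap.enum_fset (fset_set (range g)))
      y * \1_(g @^-1` [set y]) x); last first.
    by apply/funext => x; rewrite fimfunE fsbig_finite.
  have bg y : bounded_mfun (\1_(g @^-1` [set y]) : T -> R).
    exact: bounded_mfun_indic.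
  suff : forall s : seq R,
      bounded_mfun (fun x => \sum_(y <- s) y * \1_(g @^-1` [set y]) x) /\
      Q (fun x => \sum_(y <- s) y * \1_(g @^-1` [set y]) x).
    by move=> /(_ (finmap.enum_fset (fset_set (range g))))[].
  elim=> [|y s [IH1 IH2]].
    rewrite (_ : (fun _ => _) = fun=> 0); last first.
      by apply/funext => x; rewrite big_nil.
    by split => //; exact: bounded_mfun_cst.
  rewrite (_ : (fun _ => _) = fun x => y * \1_(g @^-1` [set y]) x +
      \sum_(y <- s) y * \1_(g @^-1` [set y]) x); last first.
    by apply/funext => x; rewrite big_cons.
  split; first by apply: bounded_mfunD => //; exact: bounded_mfunZ.
  by apply: QL => //; exact: Q1.
move=> f [mf [M fM]].
(* Approximation from below by nonnegative simple functions needs a nonnegative function, hence the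
   shift by [M], which is undone in the limit. *)
have mF : measurable_fun setT (EFin \o (fun x => f x + M)).
  by apply/measurable_EFinP; apply: measurable_funD.
have F0 x : [set: T] x -> (0%:E <= (EFin \o (fun x => f x + M)%R) x)%E.
  by move=> _; rewrite lee_fin -lerBlDr sub0r; have := fM x; rewrite ler_norml => /andP[].
pose g n := nnsfun_approx measurableT mF n.
have cg x : (g n x) @[n --> \oo] --> f x + M.
  by have /fine_cvgP[_] := cvg_nnsfun_approx measurableT mF F0 (I : setT x).
have gle n x : g n x <= f x + M.
  have := le_approx n F0 (I : setT x).
  by rewrite /g nnsfun_approxE lee_fin.
have f2M x : f x + M <= M + M by rewrite lerD2r (le_trans (ler_norm _))//.
have bg n : bounded_mfun (g n).
  split; first exact: measurable_funPT.
  by exists (M + M) => x; rewrite ger0_norm// (le_trans (gle _ _)).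
apply: (Qlim (fun n x => 1 * g n x + - M) _ (M + M + `|M|)).
- move=> n; apply: bounded_mfunD; last exact: bounded_mfun_cst.
  exact: bounded_mfunZ.
- move=> n x; rewrite mul1r (le_trans (ler_normD _ _))// normrN lerD2r.
  by rewrite ger0_norm// (le_trans (gle _ _)).
- move=> x; rewrite -[X in _ --> X](addrK M).
  under eq_fun do rewrite mul1r.
  by apply: cvgB => //; exact: cvg_cst.
- by move=> n; apply: (QL 1 (g n) (fun=> - M)) => //; exact: bounded_mfun_cst.
Qed.

End bounded_functions.

(** * Integrals of bounded functions, change of variables *)

Section probability_integrals.
Context {R : realType} {d : measure_display} {T : measurableType d}.
Variable P : probability T R.
Implicit Types (f g : T -> R).

Lemma Rintegral_bounded_lin (c : R) f g : bounded_mfun f -> bounded_mfun g ->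
  \int[P]_x (c * f x + g x) = c * \int[P]_x f x + \int[P]_x g x.
Proof.
move=> bf bg; rewrite RintegralD//; first last.
- exact: bounded_mfun_integrable.
- by apply: bounded_mfun_integrable; exact: bounded_mfunZ.
by rewrite RintegralZl//; exact: bounded_mfun_integrable.
Qed.

Lemma Rintegral_indic (E : set T) : measurable E ->
  \int[P]_x \1_E x = fine (P E).
Proof. by move=> mE; rewrite /Rintegral integral_indic// setIT. Qed.

Lemma Rintegral_bounded_cvg (f_ : nat -> T -> R) f (M : R) :
  (forall n, measurable_fun setT (f_ n)) -> measurable_fun setT f ->
  (forall n x, `|f_ n x| <= M) ->
  {ae P, forall x, f_ ^~ x @ \oo --> f x} ->
  (fun n => \int[P]_x f_ n x) @ \oo --> \int[P]_x f x.
Proof.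
move=> mf_ mf fM cf.
have iM : P.-integrable setT (EFin \o (fun=> M)).
  by apply: bounded_mfun_integrable; exact: bounded_mfun_cst.
have [] := @dominated_convergence _ _ _ P setT measurableT
  (fun n => EFin \o f_ n) (EFin \o f) (EFin \o (fun=> M)).
- by move=> n; exact/measurable_EFinP.
- exact/measurable_EFinP.
- apply: filterS cf => x cfx _.
  by apply: cvg_EFin => //; exact: nearW.
- exact: iM.
- by apply: aeW => x n _ /=; rewrite lee_fin.
move=> If _ cv.
by apply: fine_cvg; rewrite fineK//; exact: integrable_fin_num.
Qed.

End probability_integrals.

Section laws.
Context {R : realType} {d1 d2 : measure_display}.
Context {X : measurableType d1} {Y : measurableType d2}.
Variables (P : probability X R) (phi : X -> Y) (nu : {measure set Y -> \bar R}).
Hypothesis mphi : measurable_fun setT phi.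
Hypothesis nuE : forall E, measurable E -> nu E = P (phi @^-1` E).

(** The image law enters only through its values on measurable sets, so [nu] need not be a syntactic
    pushforward: it can be the Gaussian law compared with its own reflection. *)
Lemma law_ge0_integral (f : Y -> \bar R) : measurable_fun setT f ->
  (forall y, (0 <= f y)%E) -> (\int[nu]_y f y = \int[P]_x f (phi x))%E.
Proof.
move=> mf f0; rewrite -(@ge0_integral_pushforward _ _ _ _ R phi mphi P setT)//.
apply: eq_measure_integral => E mE _; exact: nuE.
Qed.

Lemma law_integrable (f : Y -> R) : measurable_fun setT f ->
  P.-integrable setT (EFin \o (f \o phi)) -> nu.-integrable setT (EFin \o f).
Proof.
move=> mf /integrableP[_ iP]; apply/integrableP; split.
  exact/measurable_EFinP.
rewrite law_ge0_integral//.
by apply/measurable_EFinP; apply: measurableT_comp.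
Qed.

Lemma law_integrableP (f : Y -> R) : measurable_fun setT f ->
  nu.-integrable setT (EFin \o f) -> P.-integrable setT (EFin \o (f \o phi)).
Proof.
move=> mf /integrableP[_ iP]; apply/integrableP; split.
  by apply/measurable_EFinP; apply: measurableT_comp.
rewrite law_ge0_integral// in iP.
by apply/measurable_EFinP; apply: measurableT_comp.
Qed.

Lemma law_Rintegral (f : Y -> R) : measurable_fun setT f ->
  \int[nu]_y f y = \int[P]_x f (phi x).
Proof.
move=> mf; rewrite /Rintegral integralE [in RHS]integralE; congr (fine (_ - _)%E).
  rewrite law_ge0_integral//; first by apply: eq_integral => x _; rewrite !funeposE.
  exact/measurable_funepos/measurable_EFinP.
rewrite law_ge0_integral//; first by apply: eq_integral => x _; rewrite !funenegE.
exact/measurable_funeneg/measurable_EFinP.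
Qed.

End laws.

(** * Measurability and Euclidean geometry of column vectors *)

Section measurable_vectors.
Context {R : realType} {m : nat}.

Lemma measurable_coord (i : 'I_m) :
  measurable_fun setT (fun x : 'cV[R]_m => x i ord0).
Proof.
move=> _ Y mY; rewrite setTI; apply: sub_sigma_algebra => /=.
rewrite -bigcup_seq/=; exists i => /=; first by rewrite mem_index_enum.
by exists Y => //; rewrite setTI.
Qed.

Lemma measurable_vec {d : measure_display} {T : measurableType d}
    (f : T -> 'cV[R]_m) :
  (forall i, measurable_fun setT (fun t => f t i ord0)) ->
  measurable_fun setT f.
Proof.
move=> mf _ A mA; rewrite setTI.
pose G := [set A : set 'cV[R]_m | measurable (f @^-1` A)].
suff : measurable `<=` G by exact.
apply: smallest_sub.
  split; rewrite /G /=.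
  - by rewrite preimage_set0.
  - by move=> B mB; rewrite setTD preimage_setC; exact: measurableC.
  - by move=> F mF; rewrite preimage_bigcup; exact: bigcup_measurable.
rewrite -bigcup_seq => B [i _ [C mC <-]] /=; rewrite /G /= setTI.
by rewrite -[X in measurable X]setTI; exact: mf.
Qed.

Lemma measurable_dotcV (u : 'cV[R]_m) : measurable_fun setT (dotcV u).
Proof.
apply: measurable_sum => i; apply: measurable_funM => //.
exact: measurable_coord.
Qed.

End measurable_vectors.

Section dot_product.
Context {R : realType} {m : nat}.
Implicit Types u v w : 'cV[R]_m.

Lemma dotcVC u v : dotcV u v = dotcV v u.
Proof. by apply: eq_bigr => i _; rewrite mulrC. Qed.

Lemma dotcVDl u v w : dotcV (u + v) w = dotcV u w + dotcV v w.
Proof. by rewrite -big_split; apply: eq_bigr => i _; rewrite mxE mulrDl. Qed.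

Lemma dotcVDr u v w : dotcV w (u + v) = dotcV w u + dotcV w v.
Proof. by rewrite dotcVC dotcVDl !(dotcVC _ w). Qed.

Lemma dotcVZl c u w : dotcV (c *: u) w = c * dotcV u w.
Proof. by rewrite mulr_sumr; apply: eq_bigr => i _; rewrite mxE mulrA. Qed.

Lemma dotcVZr c u w : dotcV w (c *: u) = c * dotcV w u.
Proof. by rewrite dotcVC dotcVZl dotcVC. Qed.

Lemma dotcVNl u w : dotcV (- u) w = - dotcV u w.
Proof. by rewrite -scaleN1r dotcVZl mulN1r. Qed.

Lemma dotcVNr u w : dotcV w (- u) = - dotcV w u.
Proof. by rewrite -scaleN1r dotcVZr mulN1r. Qed.

Lemma dotcVBr u v w : dotcV w (u - v) = dotcV w u - dotcV w v.
Proof. by rewrite dotcVDr dotcVNr. Qed.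

Lemma dotcV0l w : dotcV 0 w = 0.
Proof. by apply: big1 => i _; rewrite mxE mul0r. Qed.

Lemma dotcV0r w : dotcV w 0 = 0.
Proof. by rewrite dotcVC dotcV0l. Qed.

Lemma dotcV_sumr (I : Type) (s : seq I) (F : I -> 'cV[R]_m) w :
  dotcV w (\sum_(i <- s) F i) = \sum_(i <- s) dotcV w (F i).
Proof.
elim: s => [|i s IH]; first by rewrite !big_nil dotcV0r.
by rewrite !big_cons dotcVDr IH.
Qed.

Lemma dotcV_suml (I : Type) (s : seq I) (F : I -> 'cV[R]_m) w :
  dotcV (\sum_(i <- s) F i) w = \sum_(i <- s) dotcV (F i) w.
Proof. by rewrite dotcVC dotcV_sumr; apply: eq_bigr => i _; rewrite dotcVC. Qed.

Lemma dotcV_delta (i : 'I_m) u : dotcV (delta_mx i ord0) u = u i ord0.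
Proof.
rewrite /dotcV (bigD1 i)//= mxE !eqxx mul1r big1 ?addr0// => j /negPf ji.
by rewrite mxE ji mul0r.
Qed.

Lemma dotcV_ge0 u : 0 <= dotcV u u.
Proof. by apply: sumr_ge0 => i _; rewrite -expr2 sqr_ge0. Qed.

End dot_product.

Lemma dotcV_mull {R : realType} {m n : nat} (A : 'M[R]_(m, n)) u v :
  dotcV (A *m u) v = dotcV u (A^T *m v).
Proof.
rewrite /dotcV; under eq_bigr do rewrite mxE mulr_suml.
rewrite exchange_big/=; apply: eq_bigr => j _.
rewrite mxE mulr_sumr; apply: eq_bigr => i _.
by rewrite !mxE mulrAC mulrC.
Qed.

(** * Laws on R^m are determined by their characteristic functions *)

Section cramer_wold.
Context {R : realType} {m : nat}.

(** Inductive, so that [cramer_wold] can proceed by induction on the construction of a function. The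
    phase [c] provides the sines as well, and the uniform bound [M] in the limit rule is what
    dominated convergence asks for. *)
Inductive trig_class : ('cV[R]_m -> R) -> Prop :=
| trig_cos u c : trig_class (fun x => cos (dotcV u x + c))
| trig_lin c f g : trig_class f -> trig_class g ->
    trig_class (fun x => c * f x + g x)
| trig_mul f g : trig_class f -> trig_class g ->
    trig_class (fun x => f x * g x)
| trig_lim (f_ : nat -> 'cV[R]_m -> R) f (M : R) :
    (forall n, trig_class (f_ n)) -> (forall n x, `|f_ n x| <= M) ->
    (forall x, f_ ^~ x @ \oo --> f x) -> trig_class f.

Lemma measurable_dotcVD (u : 'cV[R]_m) (c : R) :
  measurable_fun setT (fun x => dotcV u x + c).
Proof. by apply: measurable_funD => //; exact: measurable_dotcV. Qed.

Lemma trig_class_bounded f : trig_class f -> bounded_mfun f.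
Proof.
elim=> [u c|c {}f g _ bf _ bg|{}f g _ bf _ bg|f_ {}f M _ bf fM cf].
- by apply: bounded_mfun_cos; exact: measurable_dotcVD.
- by apply: bounded_mfunD => //; exact: bounded_mfunZ.
- exact: bounded_mfunM.
- by apply: cvg_bounded_mfun fM cf => n; have [] := bf n.
Qed.

Lemma trig_const c : trig_class (fun=> c).
Proof.
have h1 : trig_class (fun=> 1).
  rewrite (_ : (fun _ => _) = fun x => cos (dotcV 0 x + 0)).
    exact: trig_cos.
  by apply/funext => x; rewrite dotcV0l addr0 cos0.
have h0 : trig_class (fun=> 0).
  rewrite (_ : (fun _ => _) = fun x => - 1 * 1 + 1); first exact: trig_lin.
  by apply/funext => x; rewrite mulr1 addNr.
rewrite (_ : (fun _ => _) = fun x => c * 1 + 0); first exact: trig_lin.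
by apply/funext => x; rewrite mulr1 addr0.
Qed.

Lemma trig_exp f n : trig_class f -> trig_class (fun x => f x ^+ n).
Proof.
move=> tf; elim: n => [|n IH]; first exact: trig_const.
rewrite (_ : (fun _ => _) = fun x => f x * f x ^+ n); first exact: trig_mul.
by apply/funext => x; rewrite exprS.
Qed.

Lemma trig_compl f : trig_class f -> trig_class (fun x => 1 - f x).
Proof.
move=> tf; rewrite (_ : (fun _ => _) = fun x => - 1 * f x + 1).
  by apply: trig_lin => //; exact: trig_const.
by apply/funext => x; rewrite mulN1r addrC.
Qed.

(** With s = sqrt r, k s^k (1 - s) <= (1 + s + ... + s^{k-1}) (1 - s) <= 1. Hence k r^k <= s^k / (1
    - s). *)
Lemma cvg_natr_expr (r : R) : 0 <= r -> r < 1 ->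
  (fun k : nat => k%:R * r ^+ k) @ \oo --> 0.
Proof.
move=> r0 r1; pose s := Num.sqrt r.
have s0 : 0 <= s by rewrite sqrtr_ge0.
have s1 : s < 1 by rewrite -sqrtr1 ltr_sqrt.
have ks k : k%:R * s ^+ k * (1 - s) <= 1.
  have -> : k%:R * s ^+ k * (1 - s) = (\sum_(j < k) s ^+ k) * (1 - s).
    by rewrite sumr_const card_ord mulr_natl.
  apply: (@le_trans _ _ ((\sum_(j < k) s ^+ j) * (1 - s))).
    rewrite ler_wpM2r ?subr_ge0 ?(ltW s1)//; apply: ler_sum => j _.
    by apply: ler_wiXn2l => //; [exact: ltW|exact: ltnW].
  by rewrite mulrC -opprB mulNr -subrX1 opprB gerBl exprn_ge0.
apply: (@squeeze_cvgr _ _ _ _ (fun=> 0) (fun k => (1 - s)^-1 * s ^+ k)).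
- apply: nearW => k; rewrite mulr_ge0 ?exprn_ge0//=.
  have -> : r = s * s by rewrite -expr2 sqr_sqrtr.
  rewrite exprMn mulrA ler_wpM2r ?exprn_ge0//.
  by rewrite -[leRHS]mul1r ler_pdivlMr ?subr_gt0.
- exact: cvg_cst.
- rewrite -[X in _ --> X](mulr0 (1 - s)^-1); apply: cvgMr.
  by apply: cvg_expr; rewrite ger0_norm.
Qed.

Lemma bernoulli_ineq n (x : R) : 0 <= x <= 1 -> 1 - n%:R * x <= (1 - x) ^+ n.
Proof.
move=> /andP[x0 x1]; elim: n => [|n IH]; first by rewrite mul0r subr0 expr0.
rewrite exprS; apply: (@le_trans _ _ ((1 - x) * (1 - n%:R * x))).
  rewrite -subr_ge0 (_ : _ - _ = n%:R * x ^+ 2) ?mulr_ge0 ?sqr_ge0//.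
  by rewrite -natr1; ring.
by rewrite ler_wpM2l// subr_ge0.
Qed.

(* The polynomials (1 - q ^ k) ^ (k 2 ^ k) in q = (1 + s) / 2 tend to the
   indicator of s < 0 on [-1, 1], the point s = 0 included. *)
Lemma cvg_step_polynomial (s : R) : -1 <= s -> s <= 1 ->
  (fun k : nat => (1 - ((1 + s) / 2) ^+ k) ^+ (k * 2 ^ k)%N) @ \oo -->
  ((s < 0)%R%:R : R).
Proof.
move=> sN1 s1; set q := (1 + s) / 2.
have q0 : 0 <= q by rewrite divr_ge0// addrC -lerBlDr sub0r.
have q1 : q <= 1 by rewrite ler_pdivrMr// mul1r -[leRHS]/(1 + 1) lerD2l.
have qk k : 0 <= 1 - q ^+ k <= 1.
  by rewrite subr_ge0 exprn_ile1//= gerBl exprn_ge0.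
case: ltP => s0.
(* For s < 0, Bernoulli's inequality bounds the polynomial below by 1 - k (2 q)^k, and 2 q < 1. *)
- have q2 : q * 2 < 1 by rewrite divfK// -[ltRHS]addr0 ltrD2l.
  apply: (@squeeze_cvgr _ _ _ _ (fun k : nat => 1 - k%:R * (q * 2) ^+ k) (fun=> 1)).
  + apply: nearW => k; rewrite exprn_ile1 ?andbT//; last 2 first.
    * by have /andP[] := qk k.
    * by have /andP[] := qk k.
    have qk01 : 0 <= q ^+ k <= 1 by rewrite exprn_ge0//= exprn_ile1.
    apply: le_trans (bernoulli_ineq (k * 2 ^ k) qk01).
    by rewrite natrM natrX exprMn mulrAC mulrA.
  + rewrite -[X in _ --> X](subr0 1); apply: cvgB; first exact: cvg_cst.
    by apply: cvg_natr_expr => //; rewrite mulr_ge0.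
  + exact: cvg_cst.
- apply: (@squeeze_cvgr _ _ _ _ (fun=> 0) (fun k : nat => expR (- 1) ^+ k)).
  + apply: nearW => k; rewrite exprn_ge0/=; last by have /andP[] := qk k.
    rewrite mulnC exprM lerXn2r ?nnegrE ?exprn_ge0 ?expR_ge0//.
      by have /andP[] := qk k.
    (* Here q >= 1/2. Raising this bound to the power 2^k leaves e^{-1}, and the remaining power k
       gives e^{-k}; this is the reason for the exponent k 2^k. *)
    have h : 1 - q ^+ k <= expR (- (2 ^- k)).
      apply: le_trans (expR_ge1Dx _); rewrite lerD2l lerN2 -exprVn.
      rewrite lerXn2r ?nnegrE// ler_pdivlMr// mulVf//.
      by rewrite lerDl.
    apply: (@le_trans _ _ (expR (- (2 ^- k)) ^+ (2 ^ k))).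
      rewrite lerXn2r ?nnegrE ?expR_ge0//; by have /andP[] := qk k.
    by rewrite -expRM_natl natrX mulrN divff// expf_neq0.
  + exact: cvg_cst.
  + apply: cvg_expr; rewrite ger0_norm ?expR_ge0//.
Qed.

(** Compose the step polynomials with [f]: affine functions and powers stay in the class, and the
    bound keeps the argument in [-1, 1]. *)
Lemma trig_indic_lt0 f : trig_class f -> (forall x, `|f x| <= 1) ->
  trig_class (\1_[set x | f x < 0] : 'cV[R]_m -> R).
Proof.
move=> tf f1.
have f11 x : -1 <= f x /\ f x <= 1 by apply/andP; rewrite -ler_norml.
apply: (@trig_lim (fun k x =>
    (1 - ((1 + f x) / 2) ^+ k) ^+ (k * 2 ^ k)%N) _ 1).
- move=> k; apply/trig_exp/trig_compl/trig_exp.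
  rewrite (_ : (fun _ => _) = fun x => 2^-1 * f x + 2^-1).
    by apply: trig_lin => //; exact: trig_const.
  by apply/funext => x; rewrite mulrC mulrDr mulr1 addrC.
- move=> k x; have [h1 h2] := f11 x.
  have q0 : 0 <= (1 + f x) / 2 by rewrite divr_ge0// addrC -lerBlDr sub0r.
  have q1 : (1 + f x) / 2 <= 1.
    by rewrite ler_pdivrMr// mul1r -[leRHS]/(1 + 1) lerD2l.
  by rewrite normrX exprn_ile1// ger0_norm ?gerBl ?exprn_ge0// subr_ge0 exprn_ile1.
- move=> x; have [h1 h2] := f11 x.
  rewrite indicE (_ : x \in _ = (f x < 0)); first exact: cvg_step_polynomial.
  by apply/idP/idP; rewrite inE.
Qed.

(* x_i > a is detected by the sign of sin ((x_i - a) / N) for N large. *)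
Lemma trig_indic_halfspace i a :
  trig_class (\1_[set x : 'cV[R]_m | a < x i ord0] : 'cV[R]_m -> R).
Proof.
pose s (N : nat) (x : 'cV[R]_m) : R := (a - x i ord0) / N.+1%:R.
have ts N : trig_class (fun x => sin (s N x)).
  rewrite (_ : (fun _ => _) = fun x =>
      cos (dotcV (- N.+1%:R^-1 *: delta_mx i ord0) x + (a / N.+1%:R - pi / 2))).
    exact: trig_cos.
  apply/funext => x; rewrite -cosBpihalf dotcVZl dotcV_delta /s.
  by congr cos; ring.
apply: (@trig_lim (fun N => \1_[set x | sin (s N x) < 0]) _ 1).
- by move=> N; apply: trig_indic_lt0 => // x; rewrite ler_norml sin_geN1 sin_le1.
- by move=> N x; rewrite indicE; case: (_ \in _); rewrite ?normr1 ?normr0.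
move=> x; apply: cvg_near_cst.
(* From then on the argument lies in (-pi, pi), where the sine has the sign of its argument, so the
   sequence of indicators is eventually constant at x. *)
have : \forall N \near \oo, `|a - x i ord0| / pi < N.+1%:R :> R.
  near=> N; apply: (@lt_trans _ _ N%:R); last by rewrite ltr_nat.
  by near: N; exact: nbhs_infty_gtr.
apply: filterS => N; rewrite ltr_pdivrMr ?pi_gt0// mulrC => hN.
have {hN} hs : `|s N x| < pi.
  by rewrite normrM normfV [`|_%:R|]ger0_norm// ltr_pdivrMr.
rewrite !indicE; congr (nat_of_bool _)%:R; apply/idP/idP; rewrite !inE /=.
- have sE : (a < x i ord0) = (s N x < 0) by rewrite pmulr_llt0 ?invr_gt0// subr_lt0.
  rewrite sE; apply: contraTT; rewrite -!leNgt => s0; apply: sin_ge0_pi.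
  by rewrite s0/=; apply: ltW; exact: le_lt_trans (ler_norm _) hs.
- move=> ax; have sN0 : s N x < 0 by rewrite pmulr_llt0 ?invr_gt0// subr_lt0.
  rewrite -[s N x]opprK sinN oppr_lt0; apply: sin_gt0_pi.
  by rewrite oppr_gt0 sN0/= -[ltLHS]ltr0_norm.
Unshelve. all: by end_near. Qed.

(** Unions are reached through products of complements, 1 - prod (1 - 1_F), so disjointness is never
    an issue. The map [phi] allows two uses: the identity for sets of R^m, and a coordinate for
    Borel sets of the line. *)
Lemma trig_indic_sigma (aT : Type) (phi : 'cV[R]_m -> aT) :
  sigma_algebra setT
    [set E | trig_class (\1_(phi @^-1` E) : 'cV[R]_m -> R)].
Proof.
split => /=.
- rewrite (_ : \1__ = fun=> 0); first exact: trig_const.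
  by apply/funext => x; rewrite preimage_set0 indic0.
- move=> E tE; rewrite (_ : \1__ = fun x => 1 - \1_(phi @^-1` E) x).
    exact: trig_compl.
  apply/funext => x; rewrite setTD preimage_setC !indicE in_setC.
  by case: (x \in _) => /=; rewrite ?subrr ?subr0.
- move=> F tF.
  apply: (@trig_lim (fun n x => 1 - \prod_(k < n) (1 - \1_(phi @^-1` F k) x)) _ 1).
  + move=> n; apply: trig_compl; elim: n => [|n IH].
      rewrite (_ : (fun _ => _) = fun=> 1); first exact: trig_const.
      by apply/funext => x; rewrite big_ord0.
    rewrite (_ : (fun _ => _) = fun x =>
        (\prod_(k < n) (1 - \1_(phi @^-1` F k) x)) * (1 - \1_(phi @^-1` F n) x)).
      by apply: trig_mul => //; exact: trig_compl.
    by apply/funext => x; rewrite big_ord_recr.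
  + move=> n x.
    have h k : 0 <= (1 : R) - \1_(phi @^-1` F k) x <= 1.
      by rewrite indicE; case: (_ \in _); rewrite ?subrr ?subr0 ?lexx ?ler01.
    have h0 : 0 <= \prod_(k < n) (1 - \1_(phi @^-1` F k) x) :> R.
      by apply: prodr_ge0 => k _; have /andP[] := h k.
    have h1 : \prod_(k < n) (1 - \1_(phi @^-1` F k) x) <= 1 :> R.
      by apply: prodr_ile1 => k _; exact: h.
    by rewrite ger0_norm ?subr_ge0// gerBl.
  + move=> x; apply: cvg_near_cst.
    have [[k _ Fkx]|nF] := pselect ((phi @^-1` (\bigcup_k F k)) x).
      near=> n; have kn : (k < n)%N by near: n; exact: nbhs_infty_gt.
      rewrite [in RHS]indicE mem_set; last by exists k.
      rewrite (bigD1 (Ordinal kn))//= indicE mem_set// subrr mul0r subr0//.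
    near=> n; rewrite [in RHS]indicE memNset// big1 ?subrr// => k _.
    by rewrite indicE memNset ?subr0// => Fkx; apply: nF; exists k.
Unshelve. all: by end_near. Qed.

Lemma trig_indic E : measurable E -> trig_class (\1_E : 'cV[R]_m -> R).
Proof.
pose G := [set E | trig_class (\1_(id @^-1` E) : 'cV[R]_m -> R)].
suff : measurable `<=` G by exact.
apply: smallest_sub; first exact: trig_indic_sigma.
rewrite -bigcup_seq => B [i _ [C mC <-]] /=; rewrite /G /= setTI.
pose H := [set C | trig_class (\1_((fun x => x i ord0) @^-1` C) : 'cV[R]_m -> R)].
suff : measurable `<=` H by exact.
rewrite [X in X `<=` _]RGenOInfty.measurableE.
apply: smallest_sub; first exact: trig_indic_sigma.
move=> _ [a ->]; rewrite /H /=.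
rewrite (_ : _ @^-1` _ = [set x | a < x i ord0]); first exact: trig_indic_halfspace.
by apply/seteqP; split => x /=; rewrite in_itv/= andbT.
Qed.

Lemma cramer_wold (P1 P2 : probability 'cV[R]_m R) :
  (forall u c, \int[P1]_x cos (dotcV u x + c) = \int[P2]_x cos (dotcV u x + c)) ->
  forall E, measurable E -> P1 E = P2 E.
Proof.
move=> h.
pose D (f : 'cV[R]_m -> R) := bounded_mfun f /\ forall u c,
  \int[P1]_x (f x * cos (dotcV u x + c)) = \int[P2]_x (f x * cos (dotcV u x + c)).
have bc u c : bounded_mfun (fun x : 'cV[R]_m => cos (dotcV u x + c)).
  by apply: bounded_mfun_cos; exact: measurable_dotcVD.
(* Equality of the two integrals is not stable under products. Being a multiplier of [D] is, and it
   suffices because the hypothesis puts the constant 1 in [D]. *)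
suff key f : trig_class f -> forall g, D g -> D (fun x => f x * g x).
  move=> E mE.
  have D1 : D (fun=> 1).
    split; first exact: bounded_mfun_cst.
    move=> u c; under eq_Rintegral do rewrite mul1r.
    by under [RHS]eq_Rintegral do rewrite mul1r.
  have [_ /(_ 0 0)] := key _ (trig_indic mE) _ D1.
  under eq_Rintegral do rewrite dotcV0l addr0 cos0 !mulr1.
  under [RHS]eq_Rintegral do rewrite dotcV0l addr0 cos0 !mulr1.
  rewrite !Rintegral_indic// => e; have := congr1 EFin e.
  by rewrite !fineK// ?fin_num_measure.
elim=> [u c|k {}f g tf Df tg Dg|{}f g tf Df tg Dg|f_ {}f M tf Df fM cf] q [bq Dq].
- split; first exact: bounded_mfunM.
  move=> v e.
  (* Product-to-sum: a product of two cosines of affine forms is a combination of two such cosines,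
     which [Dq] covers. *)
  have E x : cos (dotcV u x + c) * q x * cos (dotcV v x + e) =
    2^-1 * (q x * cos (dotcV (u + v) x + (c + e))) +
    2^-1 * (q x * cos (dotcV (u - v) x + (c - e))).
    rewrite !(dotcVDl, dotcVNl).
    have -> : dotcV u x + dotcV v x + (c + e) =
      (dotcV u x + c) + (dotcV v x + e) by ring.
    have -> : dotcV u x - dotcV v x + (c - e) =
      (dotcV u x + c) - (dotcV v x + e) by ring.
    by move: (dotcV u x + c) (dotcV v x + e) => a b; rewrite cosD cosB; field.
  under eq_Rintegral do rewrite E; under [RHS]eq_Rintegral do rewrite E.
  have bq1 w k : bounded_mfun (fun x => q x * cos (dotcV w x + k)).
    exact: bounded_mfunM.
  have bq2 w k : bounded_mfun (fun x => 2^-1 * (q x * cos (dotcV w x + k))).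
    exact: (bounded_mfunZ 2^-1 (bq1 w k)).
  rewrite !Rintegral_bounded_lin// !RintegralZl ?Dq//.
    exact: bounded_mfun_integrable.
  exact: bounded_mfun_integrable.
- have [bf Ef] := Df _ (conj bq Dq); have [bg Eg] := Dg _ (conj bq Dq).
  rewrite (_ : (fun _ => _) = fun x => k * (f x * q x) + g x * q x); last first.
    by apply/funext => x; rewrite mulrDl mulrA.
  split; first by apply: bounded_mfunD => //; exact: bounded_mfunZ.
  move=> u c; under eq_Rintegral do rewrite mulrDl -mulrA.
  under [RHS]eq_Rintegral do rewrite mulrDl -mulrA.
  by rewrite !Rintegral_bounded_lin ?Ef ?Eg//; exact: bounded_mfunM.
- rewrite (_ : (fun _ => _) = fun x => f x * (g x * q x)); last first.
    by apply/funext => x; rewrite mulrA.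
  by apply: Df; apply: Dg.
- have bf : bounded_mfun f.
    by apply: cvg_bounded_mfun fM cf => n; have [] := trig_class_bounded (tf n).
  split; first exact: bounded_mfunM.
  move=> u c; have [mq [K qK]] := bq.
  have lim (P : probability 'cV[R]_m R) :
     (fun n => \int[P]_x (f_ n x * q x * cos (dotcV u x + c))) @ \oo -->
     \int[P]_x (f x * q x * cos (dotcV u x + c)).
    apply: (@Rintegral_bounded_cvg _ _ _ P _ _ (M * K)).
    + move=> n; apply: measurable_funM; last by have [] := bc u c.
      by apply: measurable_funM => //; have [] := trig_class_bounded (tf n).
    + apply: measurable_funM; last by have [] := bc u c.
      by apply: measurable_funM => //; have [] := bf.
    + move=> n x; rewrite !normrM -[leRHS]mulr1.
      by rewrite ler_pM ?mulr_ge0// ?ler_pM// ler_norml cos_geN1 cos_le1.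
    + apply: aeW => x; apply: cvgM; last exact: cvg_cst.
      by apply: cvgM; [exact: cf|exact: cvg_cst].
  have E : (fun n => \int[P1]_x (f_ n x * q x * cos (dotcV u x + c))) =
           (fun n => \int[P2]_x (f_ n x * q x * cos (dotcV u x + c))).
    by apply/funext => n; have [_] := Df n _ (conj bq Dq).
  rewrite -(cvg_lim _ (lim P1))// -(cvg_lim _ (lim P2))//.
  by rewrite E.
Qed.

End cramer_wold.

(** * The standard normal law: density, moments, affine images *)

Section standard_normal.
Context {R : realType}.
Local Notation leb := (@lebesgue_measure R).
Local Notation gauss := (normal_prob (0 : R) 1 : probability (measurableTypeR R) R).
Local Notation pdf := (@normal_pdf R 0 1).

Lemma normal_pdf01E x : pdf x = normal_peak 1 * expR (- (x ^+ 2 / 2)).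
Proof.
rewrite normal_pdfE//; congr (_ * expR _).
by rewrite subr0 expr1n mulNr.
Qed.

Lemma bounded_mfun_pdf_integrable f : bounded_mfun f ->
  leb.-integrable setT (EFin \o (fun x => f x * pdf x)).
Proof.
move=> [mf [M fM]].
apply: (@le_integrable _ _ _ leb _ measurableT _ (fun x => (`|M| * pdf x)%:E)).
- by apply/measurable_EFinP; apply: measurable_funM => //; exact: measurable_normal_pdf.
- move=> x _ /=; rewrite lee_fin !normrM normr_id ler_wpM2r//.
  by rewrite (le_trans (fM x)) ?ler_norm.
- under eq_fun do rewrite EFinM.
  by apply: integrableZl => //; exact: integrable_normal_pdf.
Qed.

(** On indicators this is the definition of [normal_prob]; [bounded_mfun_ind] carries it to bounded
    functions. *)
Lemma Rintegral_gauss_bounded f : bounded_mfun f ->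
  \int[gauss]_x f x = \int[leb]_x (f x * pdf x).
Proof.
move: f; apply: bounded_mfun_ind => [E mE|c f g bf bg Ef Eg|f_ f M bf fM cf Ef].
- rewrite Rintegral_indic//= /normal_prob /Rintegral [in LHS]integral_mkcond.
  congr fine; apply: eq_integral => x _; rewrite /= patchE indicE.
  by case: (x \in E); rewrite ?mul1r ?mul0r.
- rewrite Rintegral_bounded_lin// Ef Eg.
  under [RHS]eq_Rintegral do rewrite mulrDl -mulrA.
  rewrite RintegralD//; first last.
  + exact: bounded_mfun_pdf_integrable.
  + rewrite [X in _.-integrable _ X](_ : _ = (fun x => c%:E * (f x * pdf x)%:E)%E)//.
    by apply: integrableZl => //; exact: bounded_mfun_pdf_integrable.
  by rewrite RintegralZl//; exact: bounded_mfun_pdf_integrable.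
- have mf : measurable_fun setT f.
    by apply: (measurable_fun_cvg _ (fun x _ => cf x)) => // n; have [] := bf n.
  have h1 : (fun n => \int[gauss]_x f_ n x) @ \oo --> \int[gauss]_x f x.
    apply: (Rintegral_bounded_cvg _ _ fM) => //; last exact: aeW.
    by move=> n; have [] := bf n.
  have h2 : (fun n => \int[leb]_x (f_ n x * pdf x)) @ \oo --> \int[leb]_x (f x * pdf x).
    have [] := @dominated_convergence _ _ _ leb setT measurableT
      (fun n x => (f_ n x * pdf x)%:E) (fun x => (f x * pdf x)%:E)
      (fun x => (`|M| * pdf x)%:E).
    + move=> n; apply/measurable_EFinP; apply: measurable_funM => //.
        by have [] := bf n.
      exact: measurable_normal_pdf.
    + apply/measurable_EFinP; apply: measurable_funM => //.
      exact: measurable_normal_pdf.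
    + apply: aeW => x _; apply: cvg_EFin; first exact: nearW.
      by apply: cvgM; [exact: cf|exact: cvg_cst].
    + under eq_fun do rewrite EFinM.
      by apply: integrableZl => //; exact: integrable_normal_pdf.
    + apply: aeW => x n _ /=; rewrite lee_fin normrM.
      rewrite [`|pdf x|]ger0_norm ?normal_pdf_ge0// ler_wpM2r ?normal_pdf_ge0//.
      by rewrite (le_trans (fM _ _))// ler_norm.
    move=> If _ cv.
    by apply: fine_cvg; rewrite fineK//; exact: integrable_fin_num.
  have E : (fun n => \int[gauss]_x f_ n x) = (fun n => \int[leb]_x (f_ n x * pdf x)).
    by apply/funext.
  by rewrite -(cvg_lim _ h1)// -(cvg_lim _ h2)// E.
Qed.

(** The square is unbounded, so it is truncated to min (x^2, n) and both sides are passed to the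
    limit by monotone convergence. *)
Lemma integral_gauss_sqr : (\int[gauss]_x (x ^+ 2)%:E = \int[leb]_x (x ^+ 2 * pdf x)%:E)%E.
Proof.
pose f_ (n : nat) (x : R) := Num.min (x ^+ 2) n%:R.
have mf n : measurable_fun setT (f_ n).
  exact: measurable_minr.
have f0 n x : 0 <= f_ n x by rewrite le_min sqr_ge0/=.
have bf n : bounded_mfun (f_ n).
  split => //; exists n%:R => x.
  by rewrite ger0_norm// ge_min lexx orbT.
have ndf x : {homo (fun n => f_ n x) : a b / (a <= b)%N >-> a <= b}.
  move=> a b ab; rewrite /f_ le_min ge_min lexx /= ge_min.
  by rewrite ler_nat ab orbT.
have cf x : (fun n => f_ n x) @ \oo --> x ^+ 2.
  apply: cvg_near_cst; near=> n; apply: min_l.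
  by near: n; exact: nbhs_infty_ger.
have mpdf : measurable_fun setT pdf by exact: measurable_normal_pdf.
have mfp n : measurable_fun setT (fun x => f_ n x * pdf x).
  exact: measurable_funM.
have h1 : (fun n => \int[gauss]_x (f_ n x)%:E)%E @ \oo --> (\int[gauss]_x (x ^+ 2)%:E)%E.
  rewrite (_ : (\int[gauss]_x (x ^+ 2)%:E = \int[gauss]_x (limn (fun n => (f_ n x)%:E)))%E).
    apply: cvg_monotone_convergence => //.
    - by move=> n; apply/measurable_EFinP; exact: mf.
    - by move=> n x _; rewrite lee_fin.
    - by move=> x _ a b ab; rewrite lee_fin ndf.
  apply: eq_integral => x _; apply/esym/cvg_lim => //.
  by apply: cvg_EFin; [exact: nearW|exact: cf].
have h2 : (fun n => \int[leb]_x (f_ n x * pdf x)%:E)%E @ \oo --> (\int[leb]_x (x ^+ 2 * pdf x)%:E)%E.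
  rewrite (_ : (\int[leb]_x (x ^+ 2 * pdf x)%:E = \int[leb]_x (limn (fun n => (f_ n x * pdf x)%:E)))%E).
    apply: cvg_monotone_convergence => //.
    - by move=> n; apply/measurable_EFinP; exact: mfp.
    - by move=> n x _; rewrite lee_fin mulr_ge0// normal_pdf_ge0.
    - by move=> x _ a b ab; rewrite lee_fin ler_wpM2r ?normal_pdf_ge0// ndf.
  apply: eq_integral => x _; apply/esym/cvg_lim => //.
  by apply: cvg_EFin; [exact: nearW|apply: cvgM; [exact: cf|exact: cvg_cst]].
have E n : (\int[gauss]_x (f_ n x)%:E = \int[leb]_x (f_ n x * pdf x)%:E)%E.
  have := congr1 EFin (Rintegral_gauss_bounded (bf n)).
  rewrite /Rintegral !fineK//.
    exact: integrable_fin_num (bounded_mfun_pdf_integrable (bf n)).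
  exact: integrable_fin_num (bounded_mfun_integrable gauss (bf n)).
rewrite -(cvg_lim _ h1)// -(cvg_lim _ h2)//.
by congr (limn _); apply/funext.
Unshelve. all: by end_near. Qed.

(** Since pdf' = - x pdf, this integrates by parts the second moment: over [0, n] it differs from
    the integral of the density by a boundary term. *)
Lemma normal_pdf01_deriv (x : R) :
  is_derive x 1 (fun y => y * pdf y) (pdf x - x ^+ 2 * pdf x).
Proof.
under eq_fun do rewrite normal_pdf01E.
rewrite normal_pdf01E.
apply: is_derive_eq.
rewrite !scaler0 add0r /GRing.scale/= !mulr1.
by field.
Qed.

Lemma normal_pdf01_tail : (fun n : nat => n%:R * pdf n%:R) @ \oo --> (0 : R).
Proof.
(* From e^{n^2/2} >= 1 + n^2/2 one gets n e^{-n^2/2} <= 2 / n. *)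
apply: (@squeeze_cvgr _ _ _ _ (fun=> 0) (fun n => (normal_peak 1 * 2) * n%:R^-1)).
- near=> n.
  have n0 : 0 < n%:R :> R by rewrite ltr0n; near: n; exact: nbhs_infty_gt.
  rewrite mulr_ge0 ?normal_pdf_ge0//=.
  rewrite normal_pdf01E mulrCA -mulrA ler_wpM2l ?normal_peak_ge0//.
  rewrite expRN ler_pdivrMr ?expR_gt0//.
  apply: (@le_trans _ _ (2 / n%:R * (1 + n%:R ^+ 2 / 2))).
    rewrite -subr_ge0 (_ : _ - _ = 2 / n%:R) ?divr_ge0//.
    by field; rewrite gt_eqF.
  by rewrite ler_wpM2l ?divr_ge0// expR_ge1Dx.
- exact: cvg_cst.
- rewrite -[X in _ --> X](mulr0 (normal_peak 1 * 2)).
  apply: cvgMr; apply/gtr0_cvgV0; last exact: cvgr_idn.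
  by near=> n; rewrite ltr0n; near: n; exact: nbhs_infty_gt.
Unshelve. all: by end_near. Qed.

Lemma continuous_normal_pdf01 : continuous pdf.
Proof. by apply: continuous_normal_pdf; exact: oner_neq0. Qed.

Lemma integral_sqr_normal_pdf_itv (n : nat) : (0 < n)%N ->
  (\int[leb]_(x in `[0%R, n%:R]) (x ^+ 2 * pdf x)%:E =
   \int[leb]_(x in `[0%R, n%:R]) (pdf x)%:E - (n%:R * pdf n%:R)%:E)%E.
Proof.
move=> n0.
have cpdf := continuous_normal_pdf01.
have csq : continuous (fun x : R => x ^+ 2 * pdf x).
  by move=> x; apply: cvgM; [exact: exprn_continuous|exact: cpdf].
have itv (f : R -> R) : continuous f ->
    leb.-integrable `[0%R, n%:R] (EFin \o f).
  move=> cf; apply: continuous_compact_integrable; first exact: segment_compact.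
  exact: continuous_subspaceT.
have := @continuous_FTC2 R (fun x => pdf x - x ^+ 2 * pdf x) (fun x => x * pdf x) 0 n%:R.
rewrite ltr0n mul0r sube0 => /(_ n0) FTC.
have {}FTC : (\int[leb]_(x in `[0%R, n%:R]) (pdf x - x ^+ 2 * pdf x)%:E =
    (n%:R * pdf n%:R)%:E)%E.
  apply: FTC.
  - by apply: continuous_subspaceT => x; apply: cvgB; [exact: cpdf|exact: csq].
  - have cF : continuous (fun x : R => x * pdf x).
      by move=> x; apply: cvgM; [exact: cvg_id|exact: cpdf].
    split.
    + by move=> x _; have [] := normal_pdf01_deriv x.
    + by apply: cvg_at_right_filter; exact: cF.
    + by apply: cvg_at_left_filter; exact: cF.
  - by move=> x _; rewrite derive1E; have /@derive_val -> := normal_pdf01_deriv x.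
rewrite -FTC integralB_EFin//; [|exact: itv|exact: itv].
have fin (f : R -> R) : continuous f ->
    (\int[leb]_(x in `[0%R, n%:R]) (f x)%:E)%E \is a fin_num.
  by move=> cf; apply: integrable_fin_num => //; exact: itv.
rewrite -(fineK (fin _ cpdf)) -(fineK (fin _ csq)).
by rewrite -!EFinB subKr.
Qed.

Lemma integral_normal_pdf_half :
  (\int[leb]_(x in `[0%R, +oo[) (pdf x)%:E = (2^-1)%:E)%E.
Proof.
have := @ge0_symfun_integralT R pdf.
rewrite integral_normal_pdf => /(_ (normal_pdf_ge0 _ _)) /(_ continuous_normal_pdf01).
rewrite (_ : [set x | 0 <= x] = `[0, +oo[%classic); last first.
  by apply/seteqP; split => x /=; rewrite in_itv/= andbT.
have sym : pdf =1 pdf \o -%R by move=> x; rewrite /= !normal_pdf01E sqrrN.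
move=> /(_ sym) h.
have fin : (\int[leb]_(x in `[0%R, +oo[) (pdf x)%:E)%E \is a fin_num.
  apply: integrable_fin_num => //; apply: (integrableS measurableT) => //.
  exact: integrable_normal_pdf.
rewrite -(fineK fin) in h *; congr EFin.
have [] := EFin_inj h => /esym/(congr1 (fun z => 2^-1 * z)).
by rewrite mulrA mulVf// mul1r mulr1.
Qed.

Lemma integral_gauss_sqr1 : (\int[gauss]_x (x ^+ 2)%:E = 1)%E.
Proof.
rewrite integral_gauss_sqr.
have cpdf := continuous_normal_pdf01.
have f0 (x : R) : 0 <= x ^+ 2 * pdf x by rewrite mulr_ge0 ?sqr_ge0 ?normal_pdf_ge0.
have csq : continuous (fun x : R => x ^+ 2 * pdf x).
  by move=> x; apply: cvgM; [exact: exprn_continuous|exact: cpdf].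
(* By evenness the half-line suffices. There the truncated second moment and the truncated mass
   differ by n pdf(n), so both tend to 1/2. *)
rewrite (@ge0_symfun_integralT R (fun x => x ^+ 2 * pdf x))//; last first.
  by move=> x; rewrite /= !normal_pdf01E sqrrN.
rewrite (_ : [set x | 0 <= x] = `[0, +oo[%classic); last first.
  by apply/seteqP; split => x /=; rewrite in_itv/= andbT.
have := @ge0_cvgn_integral R leb _ f0 (continuous_measurable_fun csq).
have h2 := @ge0_cvgn_integral R leb _ (normal_pdf_ge0 0 1) (measurable_normal_pdf 0 1).
rewrite integral_normal_pdf_half in h2.
have h3 : (fun n : nat => (n%:R * pdf n%:R)%:E) @ \oo --> (0 : R)%:E.
  by apply: cvg_EFin; [exact: nearW|exact: normal_pdf01_tail].
have h4 := cvgeB _ h2 h3.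
rewrite oppe0 adde0 in h4.
move=> h1; suff -> : (\int[leb]_(x in `[0%R, +oo[) (x ^+ 2 * pdf x)%:E = (2^-1)%:E)%E.
  by rewrite -EFinM divff.
apply: (cvg_unique _ h1) => //.
have {}h4 := h4 _ isT.
apply: cvg_trans (h4 _); apply: near_eq_cvg; near=> n.
by rewrite integral_sqr_normal_pdf_itv//; near: n; exact: nbhs_infty_gt.
Unshelve. all: by end_near. Qed.

(** Lebesgue measure and the density are both invariant under reflection. This is what makes odd
    functions integrate to 0. *)
Lemma gaussN E : measurable E -> gauss E = gauss (-%R @^-1` E).
Proof.
move=> mE; rewrite /normal_prob.
pose opp : measurableTypeR R -> measurableTypeR R := fun y : R => 0 - y.
have mN : measurable_fun setT opp by exact: measurable_funB.
have oppN : opp = -%R by apply/funext => y; rewrite /opp sub0r.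
have oppE A : measurable A -> leb A = pushforward leb opp A.
  by move=> mA; rewrite oppN; exact/esym/lebesgue_measureN.
rewrite -oppN.
change (\int[leb]_(x in E) (pdf x)%:E = \int[leb]_(x in opp @^-1` E) (pdf x)%:E)%E.
rewrite (eq_measure_integral _ (fun A mA _ => oppE A mA)).
have mpdf : measurable_fun E (fun x => (pdf x)%:E).
  by apply/measurable_EFinP/measurable_funTS; exact: measurable_normal_pdf.
have pdf0 : {in E, forall x, (0 <= (pdf x)%:E)%E}.
  by move=> x _; rewrite lee_fin normal_pdf_ge0.
rewrite (@ge0_integral_pushforward _ _ _ _ R _ mN leb _ _ mE mpdf pdf0).
by apply: eq_integral => x _; rewrite /= !normal_pdf01E /opp sub0r sqrrN.
Qed.

Lemma normal_prob_affine (a s : R) E : 0 < s -> measurable E ->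
  normal_prob a s E = gauss ((fun y => a + s * y) @^-1` E).
Proof.
move=> s0 mE; rewrite /normal_prob.
pose phi : measurableTypeR R -> measurableTypeR R := fun y : R => a + s * y.
have mphi : measurable_fun setT phi.
  by apply: measurable_funD => //; exact: measurable_funM.
pose sp : {nonneg R} := NngNum (ltW s0).
(* By uniqueness of Lebesgue measure it is enough to compare lengths of the intervals ]c, e]; the
   factor s is the Jacobian. *)
have scaleE A : measurable A -> leb A = mscale sp (pushforward leb phi) A.
  apply: lebesgue_measure_unique => _ [[c e]] _ <-.
  change (leb `]c, e] = s%:E * leb (phi @^-1` `]c, e]))%E.
  rewrite (_ : phi @^-1` _ = `](c - a) / s, (e - a) / s]%classic); last first.
    apply/seteqP; split => x /=; rewrite !in_itv/= /phi.
      by rewrite ltr_pdivrMr// ler_pdivlMr// ltrBlDl lerBrDl mulrC.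
    by rewrite ltr_pdivrMr// ler_pdivlMr// ltrBlDl lerBrDl mulrC.
  rewrite !lebesgue_measure_itv/= !lte_fin ltr_pM2r ?invr_gt0// ltrD2r.
  case: ifP => _; last by rewrite mule0.
  rewrite -!EFinD -EFinM; congr EFin; field.
  by rewrite gt_eqF.
have mpdf : measurable_fun setT (fun x => (normal_pdf a s x)%:E).
  by apply/measurable_EFinP; exact: measurable_normal_pdf.
rewrite (eq_measure_integral _ (fun A mA _ => scaleE mphi A mA)).
rewrite ge0_integral_mscale//; first last.
- by move=> x _; rewrite lee_fin normal_pdf_ge0.
- exact: measurable_funTS.
rewrite (@ge0_integral_pushforward _ _ _ _ R _ mphi leb)//; first last.
- by move=> x _; rewrite lee_fin normal_pdf_ge0.
- exact: measurable_funTS.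
rewrite -ge0_integralZl//=; first last.
- by rewrite lee_fin ltW.
- by move=> x _; rewrite lee_fin normal_pdf_ge0.
- by apply: measurable_funTS; exact: measurableT_comp mpdf mphi.
- by rewrite -[X in measurable X]setTI; exact: mphi.
apply: eq_integral => x _; rewrite /= -EFinM; congr EFin.
rewrite normal_pdf01E normal_pdfE ?gt_eqF// /normal_peak.
rewrite !(mulr_natr, expr1n, mul1r) mulrA; congr (_ * expR _); last first.
  rewrite /phi addrC addKr; field; by rewrite gt_eqF.
rewrite -mulrnAr sqrtrM ?sqr_ge0// sqrtr_sqr gtr0_norm// invfM mulrA divff ?mul1r//.
by rewrite gt_eqF.
Qed.

(** Removes the case distinction of [normal1]: for v = 0 the affine map is constant, so the image of
    the Gaussian is the Dirac mass. *)
Lemma normal1E (a v : R) E : 0 <= v -> measurable E ->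
  normal1 a v E = gauss ((fun y => a + Num.sqrt v * y) @^-1` E).
Proof.
move=> v0 mE; rewrite /normal1; case: eqVneq => [->|vn0].
  rewrite sqrtr0 diracE; case: (boolP (a \in E)) => aE.
    rewrite (_ : _ @^-1` _ = setT) ?probability_setT//.
    apply/seteqP; split => // x _ /=; rewrite mul0r addr0; exact/set_mem.
  rewrite (_ : _ @^-1` _ = set0) ?measure0//.
  apply/seteqP; split => // x /=; rewrite mul0r addr0 => /mem_set.
  by rewrite (negbTE aE).
by apply: normal_prob_affine => //; rewrite sqrtr_gt0 lt_def vn0.
Qed.

Lemma integrable_gauss_sqr : gauss.-integrable setT (fun x => (x ^+ 2)%:E).
Proof.
apply/integrableP; split; first by apply/measurable_EFinP.
under eq_integral do rewrite /= ger0_norm ?sqr_ge0//.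
by rewrite integral_gauss_sqr1 ltry.
Qed.

Lemma integrable_gauss_id : gauss.-integrable setT (fun x => x%:E).
Proof.
apply: (@le_integrable _ _ _ gauss _ measurableT _ (fun x => (1 + x ^+ 2)%:E)).
- by apply/measurable_EFinP.
- move=> x _ /=; rewrite lee_fin [leRHS]ger0_norm ?addr_ge0 ?sqr_ge0//.
  rewrite -(ler_pM2l (_ : 0 < 2 :> R))// -subr_ge0 -real_normK ?num_real//.
  rewrite (_ : _ - _ = (`|x| - 1) ^+ 2 + (1 + `|x| ^+ 2)).
    by rewrite !addr_ge0// sqr_ge0.
  by rewrite sqrrB; ring.
- under eq_fun do rewrite EFinD.
  apply: integrableD => //; last exact: integrable_gauss_sqr.
  exact: finite_measure_integrable_cst.
Qed.

Lemma Rintegral_gauss_odd (f : R -> R) : measurable_fun setT f -> (forall x, f (- x) = - f x) ->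
  gauss.-integrable setT (EFin \o f) -> \int[gauss]_x f x = 0.
Proof.
move=> mf oddf intf.
have mN : measurable_fun setT (-%R : measurableTypeR R -> measurableTypeR R) by [].
have := @law_Rintegral R _ _ (measurableTypeR R) (measurableTypeR R) gauss -%R gauss mN gaussN f mf.
under [RHS]eq_Rintegral do rewrite oddf -mulN1r.
rewrite RintegralZl// mulN1r => /eqP; rewrite -subr_eq0 opprK -mulr2n.
by rewrite mulrn_eq0/= => /eqP.
Qed.

Lemma Rintegral_gauss_sqr : \int[gauss]_x x ^+ 2 = 1.
Proof. by rewrite /Rintegral integral_gauss_sqr1. Qed.

Lemma Rintegral_gauss_id : \int[gauss]_x x = 0.
Proof. by apply: Rintegral_gauss_odd => //; exact: integrable_gauss_id. Qed.

End standard_normal.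

(** * Transfer of integrals between two maps with the same law *)

Section equal_laws.
Context {R : realType} {d1 d2 d3 : measure_display}.
Context {X : measurableType d1} {Y : measurableType d2} {Z : measurableType d3}.
Variables (P : probability X R) (Q : probability Y R) (phi : X -> Z) (psi : Y -> Z).
Hypotheses (mphi : measurable_fun setT phi) (mpsi : measurable_fun setT psi).
Hypothesis law : forall E, measurable E -> P (phi @^-1` E) = Q (psi @^-1` E).

Let psi_mixin := isMeasurableFun.Build _ _ _ _ _ mpsi.
Let psi_mfun : {mfun Y >-> Z} := HB.pack psi psi_mixin.
Let nu : probability Z R := distribution Q psi_mfun.

Let nuP E : measurable E -> nu E = P (phi @^-1` E).
Proof. by move=> mE; rewrite law. Qed.

Let nuQ E : measurable E -> nu E = Q (psi @^-1` E).
Proof. by []. Qed.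

Lemma eq_law_Rintegral (f : Z -> R) : measurable_fun setT f ->
  \int[P]_x f (phi x) = \int[Q]_y f (psi y).
Proof.
by move=> mf; rewrite -(law_Rintegral mphi nuP)// -(law_Rintegral mpsi nuQ).
Qed.

Lemma eq_law_integrable (f : Z -> R) : measurable_fun setT f ->
  Q.-integrable setT (EFin \o (f \o psi)) -> P.-integrable setT (EFin \o (f \o phi)).
Proof.
move=> mf iQ; apply: (law_integrableP mphi nuP) => //.
exact: (law_integrable mpsi nuQ).
Qed.

End equal_laws.

(** * Moments and cosines of the projections of a normal vector *)

Section normal_laws.
Context {R : realType}.
Local Notation gauss := (normal_prob (0 : R) 1 : probability (measurableTypeR R) R).

(* The characteristic function of N(0, v) at 1; no closed form is needed. *)
Definition normal_char (v : R) : R := \int[gauss]_y cos (Num.sqrt v * y).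

Lemma normal_char0 : normal_char 0 = 1.
Proof.
rewrite /normal_char sqrtr0; under eq_Rintegral do rewrite mul0r cos0.
by rewrite Rintegral_cst// mul1r; have /= -> := probability_setT gauss.
Qed.

Lemma cvg_normal_char (v_ : nat -> R) v : v_ @ \oo --> v ->
  (fun n => normal_char (v_ n)) @ \oo --> normal_char v.
Proof.
move=> cv; apply: (@Rintegral_bounded_cvg _ _ _ gauss _ _ 1).
- move=> n; have [] // := @bounded_mfun_cos _ _ (measurableTypeR R)
    (fun y : R => Num.sqrt (v_ n) * y) _.
  exact: measurable_funM.
- have [] // := @bounded_mfun_cos _ _ (measurableTypeR R)
    (fun y : R => Num.sqrt v * y) _.
  exact: measurable_funM.
- by move=> n y; rewrite ler_norml cos_geN1 cos_le1.
- apply: aeW => y; apply: continuous_cvg; first exact: continuous_cos.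
  apply: cvgMl; apply: continuous_cvg => //; exact: sqrt_continuous.
Qed.

Lemma Rintegral_gauss_sin s : \int[gauss]_y sin (s * y) = 0.
Proof.
have bs : bounded_mfun (fun y : measurableTypeR R => sin (s * y)).
  by apply: bounded_mfun_sin; exact: measurable_funM.
apply: Rintegral_gauss_odd; first by have [] := bs.
  by move=> y; rewrite mulrN sinN.
exact: bounded_mfun_integrable.
Qed.

(** Expand by the addition formula; the sine term is odd and integrates to 0. *)
Lemma Rintegral_gauss_cos v c :
  \int[gauss]_y cos (c + Num.sqrt v * y) = normal_char v * cos c.
Proof.
have m1 : measurable_fun setT (fun y : measurableTypeR R => Num.sqrt v * y).
  exact: measurable_funM.
under eq_Rintegral do rewrite cosD -mulNr addrC.
rewrite Rintegral_bounded_lin; first last.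
- by apply: bounded_mfunZ; exact: bounded_mfun_cos.
- exact: bounded_mfun_sin.
rewrite Rintegral_gauss_sin mulr0 add0r RintegralZl//; first by rewrite mulrC.
by apply: bounded_mfun_integrable; exact: bounded_mfun_cos.
Qed.

Context {m : nat} {d : measure_display} {T : measurableType d}.
Variables (P : probability T R) (V : T -> 'cV[R]_m) (a : 'cV[R]_m) (C : 'M[R]_m).
Hypothesis mV : measurable_fun setT V.
Hypothesis nV : normal_law (pushforward P V) a C.

Let affine u (y : measurableTypeR R) : R :=
  dotcV u a + Num.sqrt (dotcV u (C *m u)) * y.

Let maffine u : measurable_fun setT (affine u).
Proof. by apply: measurable_funD => //; exact: measurable_funM. Qed.

Lemma measurable_dotcV_comp u : measurable_fun setT (fun x => dotcV u (V x)).
Proof. by apply: measurableT_comp mV; exact: measurable_dotcV. Qed.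

Lemma normal_law_gauss u E : measurable E ->
  P ((fun x => dotcV u (V x)) @^-1` E) = gauss (affine u @^-1` E).
Proof.
move=> mE; have [_ C0 nVE] := nV.
by rewrite -normal1E// -nVE.
Qed.

Lemma normal_law_cos u c :
  \int[P]_x cos (dotcV u (V x) + c) =
  normal_char (dotcV u (C *m u)) * cos (dotcV u a + c).
Proof.
have mc : measurable_fun setT (fun r : R => cos (r + c)).
  have [] // := @bounded_mfun_cos R _ (measurableTypeR R) (fun r : R => r + c) _.
  exact: measurable_funD.
rewrite (eq_law_Rintegral (measurable_dotcV_comp u) (maffine u)
  (fun E => @normal_law_gauss u E) mc).
rewrite -Rintegral_gauss_cos.
by apply: eq_Rintegral => y _; rewrite /affine addrAC.
Qed.

Lemma normal_law_sin0 u : a = 0 -> \int[P]_x sin (dotcV u (V x)) = 0.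
Proof.
move=> a0; under eq_Rintegral do rewrite -cosBpihalf.
by rewrite normal_law_cos a0 dotcV0r add0r cosN cos_pihalf mulr0.
Qed.

Lemma normal_law_integrable_sqr u :
  P.-integrable setT (fun x => ((dotcV u (V x) - dotcV u a) ^+ 2)%:E).
Proof.
have := @eq_law_integrable _ _ _ _ _ _ _ P gauss _ _ (measurable_dotcV_comp u)
  (maffine u) (fun E => @normal_law_gauss u E) (fun r => (r - dotcV u a) ^+ 2).
apply.
  by apply: measurable_funX; exact: measurable_funB.
rewrite [X in _.-integrable _ X](_ : _ =
    fun y => ((dotcV u (C *m u))%:E * (y ^+ 2)%:E)%E); last first.
  apply/funext => y; rewrite /= /affine addrC addKr exprMn sqr_sqrtr//.
  by have [] := nV.
by apply: integrableZl => //; exact: integrable_gauss_sqr.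
Qed.

Lemma normal_law_sqr u :
  \int[P]_x (dotcV u (V x) - dotcV u a) ^+ 2 = dotcV u (C *m u).
Proof.
have mf : measurable_fun setT (fun r : R => (r - dotcV u a) ^+ 2).
  by apply: measurable_funX; exact: measurable_funB.
rewrite (eq_law_Rintegral (measurable_dotcV_comp u) (maffine u)
  (fun E => @normal_law_gauss u E) mf).
transitivity (\int[gauss]_y (dotcV u (C *m u) * y ^+ 2)).
  apply: eq_Rintegral => y _; rewrite /affine addrC addKr exprMn sqr_sqrtr//.
  by have [] := nV.
by rewrite RintegralZl ?Rintegral_gauss_sqr ?mulr1//; exact: integrable_gauss_sqr.
Qed.

Lemma normal_law_integrable u :
  P.-integrable setT (fun x => (dotcV u (V x) - dotcV u a)%:E).
Proof.
have := @eq_law_integrable _ _ _ _ _ _ _ P gauss _ _ (measurable_dotcV_comp u)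
  (maffine u) (fun E => @normal_law_gauss u E) (fun r => r - dotcV u a).
apply; first exact: measurable_funB.
rewrite [X in _.-integrable _ X](_ : _ =
    fun y => ((Num.sqrt (dotcV u (C *m u)))%:E * y%:E)%E); last first.
  by apply/funext => y; rewrite /= /affine addrC addKr.
by apply: integrableZl => //; exact: integrable_gauss_id.
Qed.

Lemma normal_law_mean u :
  \int[P]_x (dotcV u (V x) - dotcV u a) = 0.
Proof.
have mf : measurable_fun setT (fun r : R => r - dotcV u a).
  exact: measurable_funB.
rewrite (eq_law_Rintegral (measurable_dotcV_comp u) (maffine u)
  (fun E => @normal_law_gauss u E) mf).
transitivity (\int[gauss]_y (Num.sqrt (dotcV u (C *m u)) * y)).
  by apply: eq_Rintegral => y _; rewrite /affine addrC addKr.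
by rewrite RintegralZl ?Rintegral_gauss_id ?mulr0//; exact: integrable_gauss_id.
Qed.

End normal_laws.

(** * Characteristic function of a sum of independent normal vectors *)

Section independence.
Context {R : realType} {d : measure_display} {Omega : measurableType d}.
Variable P : probability Omega R.

(** Independence speaks of events. This turns a factorization tested on indicators of [Y] into one
    for every bounded function of [Y], by [bounded_mfun_ind]. *)
Lemma uncorrelated_bounded d' (T : measurableType d') (G : Omega -> R)
    (Y : Omega -> T) (c : R) :
  bounded_mfun G -> measurable_fun setT Y ->
  (forall E, measurable E ->
     \int[P]_w (G w * \1_E (Y w)) = c * \int[P]_w \1_E (Y w)) ->
  forall h, bounded_mfun h ->
    \int[P]_w (G w * h (Y w)) = c * \int[P]_w h (Y w).
Proof.
move=> bG mY hE.
have bY (h : T -> R) : bounded_mfun h -> bounded_mfun (fun w => h (Y w)).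
  move=> [mh [M hM]]; split; first exact: measurableT_comp.
  by exists M.
apply: bounded_mfun_ind => [//|k f g bf bg Ef Eg|f_ f M bf fM cf Ef].
  transitivity (\int[P]_w (k * (G w * f (Y w)) + G w * g (Y w))).
    by apply: eq_Rintegral => w _; ring.
  rewrite (Rintegral_bounded_lin P k (bounded_mfunM bG (bY _ bf)) (bounded_mfunM bG (bY _ bg))).
  by rewrite (Rintegral_bounded_lin P k (bY _ bf) (bY _ bg)) Ef Eg; ring.
have bff : bounded_mfun f.
  by apply: cvg_bounded_mfun fM cf => n; have [] := bf n.
have h1 : (fun n => \int[P]_w f_ n (Y w)) @ \oo --> \int[P]_w f (Y w).
  apply: (@Rintegral_bounded_cvg _ _ _ P _ _ M) => //.
  - by move=> n; have [] := bY _ (bf n).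
  - by have [] := bY _ bff.
  - by apply: aeW => w; exact: cf.
have [mG [K GK]] := bG.
have h2 : (fun n => \int[P]_w (G w * f_ n (Y w))) @ \oo --> \int[P]_w (G w * f (Y w)).
  apply: (@Rintegral_bounded_cvg _ _ _ P _ _ (K * M)) => //.
  - by move=> n; have [] := bounded_mfunM bG (bY _ (bf n)).
  - by have [] := bounded_mfunM bG (bY _ bff).
  - by move=> n w; rewrite normrM ler_pM.
  - by apply: aeW => w; apply: cvgM; [exact: cvg_cst|exact: cf].
rewrite -(cvg_lim _ h2)//; apply/cvg_lim => //.
rewrite (_ : (fun n => _) = fun n => c * \int[P]_w f_ n (Y w)); last exact/funext.
exact: cvgMr.
Qed.

Variables (m k : nat) (Y : nat -> Omega -> 'cV[R]_m) (C : nat -> 'M[R]_m).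
Hypothesis mY : forall i, measurable_fun setT (Y i).
Hypothesis indY : mutually_independent P (fun i : 'I_k => Y i).
Hypothesis nY : forall i, normal_law (pushforward P (Y i)) 0 (C i).

Lemma independent_normal_cos (p : nat -> 'cV[R]_m) c :
  \int[P]_w cos (\sum_(0 <= i < k) dotcV (p i) (Y i w) + c) =
  (\prod_(0 <= i < k) normal_char (dotcV (p i) (C i *m p i))) * cos c.
Proof.
pose th i w := dotcV (p i) (Y i w).
have mth i : measurable_fun setT (th i) by exact: measurable_dotcV_comp.
have bI i (E : set 'cV[R]_m) : measurable E -> bounded_mfun (fun w => \1_E (Y i w) : R).
  move=> mE; split; first exact: measurableT_comp.
  by exists 1 => w; rewrite indicE; case: (_ \in _); rewrite ?normr1 ?normr0.
(* Interpolation: the first j variables appear inside the cosine, the others as indicators. The case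
   j = 0 is independence of events, j = k is the claim, and each step trades one indicator for a
   summand. *)
suff key j : (j <= k)%N -> forall (E : nat -> set 'cV[R]_m) c,
    (forall i, measurable (E i)) ->
    \int[P]_w (cos (\sum_(0 <= i < j) th i w + c) *
               \prod_(j <= i < k) \1_(E i) (Y i w)) =
    (\prod_(0 <= i < j) normal_char (dotcV (p i) (C i *m p i))) * cos c *
    \prod_(j <= i < k) \int[P]_w \1_(E i) (Y i w).
  have := key k (leqnn k) (fun=> set0) c (fun=> measurable0).
  under eq_Rintegral do rewrite big_geq// mulr1.
  by rewrite [X in _ * X]big_geq// mulr1.
elim: j => [_|j IH jk] E {}c mE.
  rewrite [X in X * _ * _]big_geq// mul1r.
  under eq_Rintegral do rewrite [X in cos (X + _)]big_geq// add0r.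
  rewrite RintegralZl//; last first.
    by apply: bounded_mfun_integrable; apply: bounded_mfun_prod => i; exact: bI.
  congr (_ * _).
  have mi i : measurable (Y i @^-1` E i).
    by rewrite -[X in measurable X]setTI; exact: mY.
  transitivity (\int[P]_w \1_(\bigcap_(i : 'I_k) (Y i @^-1` E i)) w).
    apply: eq_Rintegral => w _; rewrite big_mkord indicE.
    have [wI|wI] := boolP (w \in _).
      rewrite inE in wI.
      by rewrite big1// => i _; rewrite indicE mem_set//; exact: wI.
    rewrite notin_setE in wI.
    have /existsNP[i /not_implyP[_ Ei]] :
        ~ forall i : 'I_k, [set: 'I_k] i -> (Y i @^-1` E i) w by [].
    by rewrite (bigD1 i)//= indicE memNset// mul0r.
  rewrite Rintegral_indic; last first.
    by apply: fin_bigcap_measurable => // i _; exact: mi.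
  rewrite indY// big_mkord.
  transitivity (fine (\prod_(i < k) (fine (P (Y i @^-1` E i)))%:E)%E).
    congr fine; apply: eq_bigr => i _; rewrite fineK// fin_num_measure//; exact: mi.
  rewrite prodEFin/=; apply: eq_bigr => i _.
  by rewrite -(Rintegral_indic P (mi i)).
pose G c w := cos (\sum_(0 <= i < j) th i w + c) * \prod_(j.+1 <= i < k) \1_(E i) (Y i w).
have bG e : bounded_mfun (G e).
  apply: bounded_mfunM.
    by apply: bounded_mfun_cos; apply: measurable_funD => //; exact: measurable_sum.
  by apply: bounded_mfun_prod => i; exact: bI.
set K := \prod_(0 <= i < j) normal_char _ in IH.
set L := \prod_(j.+1 <= i < k) \int[P]_w \1_(E i) (Y i w).
have hG e h : bounded_mfun h ->
    \int[P]_w (G e w * h (Y j w)) = (K * cos e * L) * \int[P]_w h (Y j w).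
  apply: uncorrelated_bounded => // F mF.
  (* The induction hypothesis holds for all events, so the one at index j can be chosen as the test
     event [F]. *)
  have := IH (ltnW jk) (fun i => if i == j then F else E i) e.
  under eq_Rintegral do rewrite big_ltn// eqxx.
  rewrite [in RHS]big_ltn// eqxx.
  have -> : \prod_(j.+1 <= i < k) \int[P]_w \1_(if i == j then F else E i) (Y i w) = L.
    by apply: eq_big_nat => i /andP[ji _]; rewrite gtn_eqF.
  move=> IHF; transitivity (K * cos e * (\int[P]_w \1_F (Y j w) * L)); last by ring.
  rewrite -IHF; last by move=> i; case: ifP.
  apply: eq_Rintegral => w _; rewrite /G -!mulrA; congr (_ * _).
  rewrite mulrC; congr (_ * _).
  by apply: eq_big_nat => i /andP[ji _]; rewrite gtn_eqF.
have md := @measurable_dotcV R m (p j).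
have bc := bounded_mfun_cos md; have bs := bounded_mfun_sin md.
(* In cos (a + b) = cos a cos b - sin a sin b, sin a is written cos (a - pi / 2), so that both terms
   contain a [G]. The sine of the centred normal [Y j] then integrates to 0. *)
transitivity (\int[P]_w (1 * (G c w * cos (dotcV (p j) (Y j w))) +
   - 1 * (G (c - pi / 2) w * sin (dotcV (p j) (Y j w))))).
  apply: eq_Rintegral => w _; rewrite big_nat_recr//= /G addrAC cosD.
  by rewrite addrA cosBpihalf -/(th j w); ring.
have bYj (h : 'cV[R]_m -> R) : bounded_mfun h -> bounded_mfun (fun w => h (Y j w)).
  move=> [mh [M hM]]; split; first exact: measurableT_comp.
  by exists M.
rewrite Rintegral_bounded_lin; first last.
- by apply: bounded_mfunZ; apply: bounded_mfunM => //; exact: (bYj _ bs).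
- by apply: bounded_mfunM => //; exact: (bYj _ bc).
rewrite RintegralZl//; last first.
  by apply: bounded_mfun_integrable; apply: bounded_mfunM => //; exact: (bYj _ bs).
rewrite (hG c _ bc) (hG (c - pi / 2) _ bs).
rewrite (normal_law_sin0 (mY j) (nY j))// big_nat_recr//=.
have := normal_law_cos (mY j) (nY j) (p j) 0.
under eq_Rintegral do rewrite addr0.
by move=> ->; rewrite addr0 dotcV0r cos0 -/K; ring.
Qed.

End independence.

(** * Finite sums of limits and derivatives, the scalar linear equation *)

Lemma cvg_sumr {R : realType} {V : normedModType R} (I : Type) (r : seq I)
    (f : I -> nat -> V) (a : I -> V) :
  (forall i, f i @ \oo --> a i) ->
  (fun n => \sum_(i <- r) f i n) @ \oo --> \sum_(i <- r) a i.
Proof.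
move=> fa; elim: r => [|i r IH].
  rewrite big_nil (_ : (fun _ => _) = fun=> 0); first exact: cvg_cst.
  by apply/funext => n; rewrite big_nil.
rewrite big_cons (_ : (fun _ => _) = fun n => f i n + \sum_(i <- r) f i n).
  exact: cvgD.
by apply/funext => n; rewrite big_cons.
Qed.

Lemma is_derive_sumr {R : realType} (I : Type) (r : seq I)
    (f : I -> R -> R) (df : I -> R) (s : R) :
  (forall i, is_derive s 1 (f i) (df i)) ->
  is_derive s 1 (fun x => \sum_(i <- r) f i x) (\sum_(i <- r) df i).
Proof.
move=> fd; elim: r => [|i r IH].
  rewrite big_nil (_ : (fun _ => _) = fun=> 0); first exact: is_derive_cst.
  by apply/funext => n; rewrite big_nil.
rewrite big_cons (_ : (fun _ => _) = fun x => f i x + \sum_(i <- r) f i x).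
  exact: is_deriveD.
by apply/funext => n; rewrite big_cons.
Qed.

Lemma is_derive_eq0_cst {R : realType} (f : R -> R) :
  (forall x : R, is_derive x 1 f 0) -> forall x, f x = f 0.
Proof. by move=> df x; exact: is_derive_0_is_cst. Qed.

Lemma linear_ode {R : realType} (f : R -> R) (k : R) :
  (forall s : R, is_derive s 1 f (k * f s)) -> forall s, f s = expR (k * s) * f 0.
Proof.
move=> df s.
have dg (x : R) : is_derive x 1 (fun x => f x * expR (- (k * x))) 0.
  have dfx := df x.
  apply: is_derive_eq; rewrite /GRing.scale/= !mulr1.
  by ring.
have := is_derive_eq0_cst dg s.
rewrite mulr0 oppr0 expR0 mulr1 => <-.
by rewrite mulrCA -expRD subrr expR0 mulr1.
Qed.

(** * The matrix exponential, entry by entry *)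

Section matrix_exponential.
Context {R : realType} {m : nat}.
Implicit Types (A C L N : 'M[R]_m).

(** The factors [L] and [N] make each entry of L e^{sA} N a scalar power series in s, and
    differentiation merely replaces L by L A. Derivatives and commutation are then statements on
    coefficients. *)
Definition expmx_coef L A N i j (k : nat) : R :=
  (L *m A ^+ k *m N) i j / k`!%:R.

Lemma expmx_coef1E L A N i j k : expmx_coef L A N i j k =
  \sum_(l < m) \sum_(p < m) L i l * expmx_coef 1%:M A 1%:M l p k * N p j.
Proof.
rewrite /expmx_coef mxE mulr_suml exchange_big/=; apply: eq_bigr => p _.
rewrite mxE !mulr_suml; apply: eq_bigr => l _.
by rewrite mul1mx mulmx1; ring.
Qed.

(** The sum of all absolute entries dominates every row sum, which is what the induction on k
    uses. *)
Lemma norm_exprmx_le A k i j :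
  `|(A ^+ k) i j| <= (\sum_i \sum_j `|A i j|) ^+ k.
Proof.
set K := \sum_i _.
have row0 l : \sum_j `|A l j| <= K.
  rewrite /K [leRHS](bigD1 l)//= lerDl.
  by apply: sumr_ge0 => ? _; exact: sumr_ge0.
elim: k i j => [|k IH] i j.
  by rewrite !expr0 mxE; case: (i == j); rewrite ?normr1 ?normr0.
rewrite exprS -mulmxE mxE (le_trans (ler_norm_sum _ _ _))//.
apply: (@le_trans _ _ (\sum_l `|A i l| * K ^+ k)).
  by apply: ler_sum => l _; rewrite normrM ler_wpM2l.
rewrite -mulr_suml exprS ler_wpM2r// exprn_ge0//.
by apply: sumr_ge0 => ? _; exact: sumr_ge0.
Qed.

Lemma is_cvg_pseries_expmx_coef L A N i j s :
  cvgn (pseries (expmx_coef L A N i j) s).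
Proof.
have h1 l p : cvgn (pseries (expmx_coef 1%:M A 1%:M l p) s).
  apply: normed_cvg.
  pose K := \sum_i \sum_j `|A i j|.
  have K0 : 0 <= K by apply: sumr_ge0 => ? _; exact: sumr_ge0.
  apply: (@series_le_cvg _ _ (exp_coeff (K * `|s|))).
  - by move=> n; exact: normr_ge0.
  - by move=> n; rewrite exp_coeff_ge0// mulr_ge0.
  - move=> n; rewrite /= normrM /expmx_coef mul1mx mulmx1 normrM normrX.
    rewrite /exp_coeff/= exprMn -mulrA [X in _ * X]mulrC mulrA.
    rewrite [`|_^-1|]ger0_norm// ler_wpM2r ?invr_ge0// ler_wpM2r ?exprn_ge0//.
    exact: norm_exprmx_le.
  - exact: is_cvg_series_exp_coeff.
apply/cvg_ex; exists (\sum_(l < m) \sum_(p < m)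
  L i l * limn (pseries (expmx_coef 1%:M A 1%:M l p) s) * N p j).
rewrite (_ : pseries _ _ = fun n => \sum_(l < m) \sum_(p < m)
    L i l * pseries (expmx_coef 1%:M A 1%:M l p) s n * N p j).
  apply: cvg_sumr => l; apply: cvg_sumr => p.
  apply: cvgM; last exact: cvg_cst.
  by apply: cvgM; [exact: cvg_cst|exact: h1].
apply/funext => n; rewrite /pseries /series/=.
under eq_bigr do rewrite expmx_coef1E mulr_suml.
rewrite exchange_big/=; apply: eq_bigr => l _.
under eq_bigr do rewrite mulr_suml.
rewrite exchange_big/=; apply: eq_bigr => p _.
rewrite mulr_sumr mulr_suml; apply: eq_bigr => q _.
by ring.
Qed.

Lemma exprZmx s A k : (s *: A) ^+ k = s ^+ k *: A ^+ k.
Proof.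
elim: k => [|k IH]; first by rewrite !expr0 scale1r.
by rewrite !exprS IH -!mulmxE -scalemxAl -scalemxAr scalerA.
Qed.

Lemma expmx_entryE L A N i j s :
  (L *m expmx (s *: A) *m N) i j = limn (pseries (expmx_coef L A N i j) s).
Proof.
pose S n := \sum_(0 <= k < n) k`!%:R^-1 *: (s *: A) ^+ k.
have SE L' N' l p n : (L' *m S n *m N') l p = pseries (expmx_coef L' A N' l p) s n.
  rewrite /S mulmx_sumr mulmx_suml summxE /pseries /series/=.
  apply: eq_bigr => k _; rewrite exprZmx -!scalemxAr -!scalemxAl !mxE /expmx_coef mxE.
  by ring.
(* [expmx] is a limit in the space of matrices; writing S n on the basis [delta_mx l p] reduces its
   convergence to that of the entries. *)
have cS : S @ \oo --> \matrix_(l, p) limn (pseries (expmx_coef 1%:M A 1%:M l p) s).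
  rewrite (_ : S = fun n => \sum_(l < m) \sum_(p < m)
      pseries (expmx_coef 1%:M A 1%:M l p) s n *: delta_mx l p); last first.
    apply/funext => n; rewrite [LHS]matrix_sum_delta; apply: eq_bigr => l _.
    by apply: eq_bigr => p _; rewrite -SE mul1mx mulmx1.
  rewrite [X in _ --> X]matrix_sum_delta; apply: cvg_sumr => l; apply: cvg_sumr => p.
  rewrite mxE; apply: cvgZr_tmp.
  exact: is_cvg_pseries_expmx_coef.
have -> : expmx (s *: A) = \matrix_(l, p) limn (pseries (expmx_coef 1%:M A 1%:M l p) s).
  by apply: cvg_lim => //; exact: norm_hausdorff.
apply/esym/cvg_lim => //.
have -> : pseries (expmx_coef L A N i j) s =
    fun n => \sum_p (\sum_l L i l * S n l p) * N p j.
  by apply/funext => n; rewrite -SE mxE; apply: eq_bigr => p _; rewrite mxE.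
rewrite mxE; apply: cvg_sumr => p; apply: cvgM; last exact: cvg_cst.
rewrite mxE; apply: cvg_sumr => l; apply: cvgM; first exact: cvg_cst.
rewrite mxE (_ : (fun n => S n l p) = pseries (expmx_coef 1%:M A 1%:M l p) s).
  exact: is_cvg_pseries_expmx_coef.
by apply/funext => n; rewrite -SE mul1mx mulmx1.
Qed.

Lemma expmxE A s : expmx (s *: A) =
  \matrix_(i, j) limn (pseries (expmx_coef 1%:M A 1%:M i j) s).
Proof. by apply/matrixP => i j; rewrite mxE -expmx_entryE mul1mx mulmx1. Qed.

Lemma expmx_coefS L A N i j :
  pseries_diffs (expmx_coef L A N i j) = expmx_coef (L *m A) A N i j.
Proof.
apply/funext => k; rewrite /pseries_diffs /expmx_coef exprS -mulmxE !mulmxA.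
by rewrite factS natrM invfM mulrCA mulVKf ?pnatr_eq0.
Qed.

Lemma is_derive_expmx_entry L A N (i j : 'I_m) (s : R) :
  is_derive s 1 (fun s => (L *m expmx (s *: A) *m N) i j)
    ((L *m A *m expmx (s *: A) *m N) i j).
Proof.
rewrite (_ : (fun s => _) = fun s => limn (pseries (expmx_coef L A N i j) s)); last first.
  by apply/funext => x; rewrite expmx_entryE.
rewrite expmx_entryE -expmx_coefS.
(* Termwise differentiation needs a point beyond |s| at which the series and its first two formal
   derivatives converge; they converge everywhere, so |s| + 1 will do. *)
apply: (@pseries_snd_diffs _ _ (`|s| + 1)); rewrite ?expmx_coefS;
  try exact: is_cvg_pseries_expmx_coef.
by rewrite [ltRHS]ger0_norm ?addr_ge0// ltrDl.
Qed.

Lemma expmx_comm A C s : C *m A = A *m C ->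
  C *m expmx (s *: A) = expmx (s *: A) *m C.
Proof.
move=> CA; have CAk k : C *m A ^+ k = A ^+ k *m C.
  elim: k => [|k IH]; first by rewrite expr0 mul1mx mulmx1.
  by rewrite exprS -mulmxE mulmxA CA -mulmxA IH mulmxA.
apply/matrixP => i j.
have := expmx_entryE C A 1%:M i j s; have := expmx_entryE 1%:M A C i j s.
rewrite mulmx1 mul1mx => -> ->; congr (limn (pseries _ _)).
by apply/funext => k; rewrite /expmx_coef mulmx1 mul1mx CAk.
Qed.

Lemma expmx_tr A s : (expmx (s *: A))^T = expmx (s *: A^T).
Proof.
have Ak k : (A ^+ k)^T = A^T ^+ k.
  elim: k => [|k IH]; first by rewrite !expr0 trmx1.
  by rewrite exprS exprSr -!mulmxE trmx_mul IH.
rewrite !expmxE; apply/matrixP => i j; rewrite !mxE.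
congr (limn (pseries _ _)); apply/funext => k.
by rewrite /expmx_coef !mul1mx !mulmx1 -Ak mxE.
Qed.

Lemma expmx0 A : expmx (0 *: A) = 1%:M.
Proof.
rewrite expmxE; apply/matrixP => i j; rewrite !mxE; apply/cvg_lim => //.
apply: cvg_near_cst; near=> n.
have n0 : (0 < n)%N by near: n; exact: nbhs_infty_gt.
rewrite /pseries /series/= big_ltn// big_nat big1 ?addr0; last first.
  by move=> k /andP[k0 _]; rewrite expr0n gtn_eqF// mulr0.
by rewrite expr0 mulr1 /expmx_coef expr0 fact0 divr1 !mul1mx mxE.
Unshelve. all: by end_near. Qed.

Lemma is_derive_expmx_vec A (u : 'cV[R]_m) (i : 'I_m) (s : R) :
  is_derive s 1 (fun s => (expmx (s *: A) *m u) i ord0)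
    ((A *m expmx (s *: A) *m u) i ord0).
Proof.
pose f l s := (1%:M *m expmx (s *: A) *m 1%:M) i l * u l ord0.
rewrite (_ : (fun s => _) = fun s => \sum_l f l s); last first.
  by apply/funext => x; rewrite mxE; apply: eq_bigr => l _; rewrite /f mul1mx mulmx1.
rewrite mxE; apply: is_derive_sumr => l.
have := is_derive_expmx_entry 1%:M A 1%:M i l s.
rewrite mul1mx => h; apply: is_derive_eq.
by rewrite /GRing.scale/= mulr0 add0r mulrC mulmx1.
Qed.

End matrix_exponential.

(** * Orthonormal eigenvectors of A + A^T and the exponential of a normal matrix *)

Section spectral_family.
Context {R : realType} {m : nat}.
Variable v : 'I_m -> 'cV[R]_m.
Hypothesis ov : orthonormal_family v.
Implicit Types u w : 'cV[R]_m.

Definition spectral_mx (r : 'I_m -> R) : 'M[R]_m :=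
  \sum_j r j *: (v j *m (v j)^T).

Lemma mul_spectral_mx r u : spectral_mx r *m u = \sum_j (r j * dotcV (v j) u) *: v j.
Proof.
rewrite /spectral_mx mulmx_suml; apply: eq_bigr => j _.
rewrite -scalemxAl -mulmxA -scalerA; congr (_ *: _).
apply/colP => i; rewrite !mxE big_ord1 mulrC; congr (_ * _).
by rewrite mxE; apply: eq_bigr => l _; rewrite mxE.
Qed.

Lemma dotcV_spectral_mx r u w :
  dotcV w (spectral_mx r *m u) = \sum_j r j * dotcV (v j) u * dotcV (v j) w.
Proof.
rewrite mul_spectral_mx dotcV_sumr; apply: eq_bigr => j _.
by rewrite dotcVZr (dotcVC w).
Qed.

(** Completeness: the matrix V of columns v_j is square, so V^T V = I implies V V^T = I. *)
Lemma spectral_mx1 : spectral_mx (fun=> 1) = 1%:M.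
Proof.
pose V : 'M[R]_m := \matrix_(i, j) v j i ord0.
have VV : V^T *m V = 1%:M.
  apply/matrixP => i j; rewrite !mxE -ov; apply: eq_bigr => l _.
  by rewrite !mxE.
rewrite -(mulmx1C VV); apply/matrixP => i j; rewrite summxE mxE.
by apply: eq_bigr => l _; rewrite scale1r !mxE big_ord1 !mxE.
Qed.

Lemma orthonormal_expansion u : u = \sum_j dotcV (v j) u *: v j.
Proof.
rewrite -[LHS]mul1mx -spectral_mx1 mul_spectral_mx.
by apply: eq_bigr => j _; rewrite mul1r.
Qed.

Lemma parseval u w : dotcV u w = \sum_j dotcV (v j) u * dotcV (v j) w.
Proof.
rewrite -[u in LHS]mul1mx -spectral_mx1 dotcVC dotcV_spectral_mx.
by apply: eq_bigr => j _; rewrite mul1r.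
Qed.

Lemma spectral_mxE r j : spectral_mx r *m v j = r j *: v j.
Proof.
rewrite mul_spectral_mx (bigD1 j)//= ov eqxx mulr1 big1 ?addr0// => i ij.
by rewrite ov (negbTE ij) mulr0 scale0r.
Qed.

Lemma tr_spectral_mx r : (spectral_mx r)^T = spectral_mx r.
Proof.
rewrite /spectral_mx raddf_sum; apply: eq_bigr => j _ /=.
by rewrite linearZ/= trmx_mul trmxK.
Qed.

Variables (A : 'M[R]_m) (phi : 'I_m -> R).
Hypothesis normalA : A *m A^T = A^T *m A.
Hypothesis eigA : forall j, (A + A^T) *m v j = phi j *: v j.

Lemma dotcV_mul_self u : dotcV u (A *m u) = 2^-1 * dotcV u ((A + A^T) *m u).
Proof.
rewrite mulmxDl dotcVDr -[X in _ + X]dotcV_mull (dotcVC _ u).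
by field.
Qed.

Lemma symmetric_part_spectral : A + A^T = spectral_mx phi.
Proof.
rewrite -[LHS]mulmx1 -spectral_mx1 /spectral_mx mulmx_sumr.
apply: eq_bigr => j _.
by rewrite scale1r mulmxA eigA -scalemxAl.
Qed.

(** <u, A u> = 1/2 sum_j phi_j <v_j, u>^2, which vanishes only if every coordinate of u does. *)
Lemma symmetric_part_posdef u : (forall j, 0 < phi j) -> u != 0 ->
  0 < dotcV u (A *m u).
Proof.
move=> phi0 u0; rewrite dotcV_mul_self mulr_gt0// symmetric_part_spectral.
rewrite dotcV_spectral_mx.
have h j : 0 <= phi j * dotcV (v j) u * dotcV (v j) u.
  by rewrite -mulrA -expr2 mulr_ge0 ?sqr_ge0 ?ltW.
rewrite lt_def sumr_ge0 ?andbT//; apply: contra u0 => /eqP/psumr_eq0P.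
move=> /(_ (fun j _ => h j)) h0.
rewrite (orthonormal_expansion u) big1// => j _.
have /eqP := h0 j isT; rewrite -mulrA mulf_eq0 gt_eqF//= mulf_eq0 orbb => /eqP ->.
by rewrite scale0r.
Qed.

(** A nonzero kernel vector u would give <u, A u> = 0. Kernels are made of rows, hence the
    transposes. *)
Lemma symmetric_part_unitmx : (forall j, 0 < phi j) -> A \in unitmx.
Proof.
move=> phi0; rewrite -unitmx_tr -row_free_unit -kermx_eq0; apply/eqP/row_matrixP => i.
rewrite row0; set y := row i _.
have yA : y *m A^T = 0 by apply/sub_kermxP; exact: row_sub.
apply/eqP; apply: contraT => y0.
have : 0 < dotcV y^T (A *m y^T).
  apply: symmetric_part_posdef => //; apply: contra y0 => /eqP h.
  by rewrite -[y]trmxK h trmx0.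
by rewrite -[A]trmxK -trmx_mul yA trmx0 dotcV0r ltxx.
Qed.

(* f' = - <e^{-sA} (A + A^T) v_j, e^{-sA} u>, since e^{-sA} commutes with A and,
   by normality, with A^T. *)
Lemma expmx_eigen_dot j u s :
  dotcV (expmx (s *: - A) *m v j) (expmx (s *: - A) *m u) =
  expR (- phi j * s) * dotcV (v j) u.
Proof.
pose f (s : R) := dotcV (expmx (s *: - A) *m v j) (expmx (s *: - A) *m u).
have df (x : R) : is_derive x 1 f (- phi j * f x).
  pose E := expmx (x *: - A).
  have d1 (w : 'cV[R]_m) i := is_derive_expmx_vec (- A) w i x.
  have -> : - phi j * f x =
     \sum_i ((E *m v j) i ord0 * (- A *m E *m u) i ord0 +
             (E *m u) i ord0 * (- A *m E *m v j) i ord0).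
    rewrite big_split/= -[X in _ = X + _]/(dotcV _ _) -[X in _ = _ + X]/(dotcV _ _).
    rewrite (dotcVC (E *m u)).
    have cA : A *m E = E *m A.
      by apply: expmx_comm; rewrite mulmxN mulNmx.
    have cAT : A^T *m E = E *m A^T.
      by apply: expmx_comm; rewrite mulmxN mulNmx normalA.
    have e : dotcV (E *m v j) (A *m (E *m u)) = dotcV (A^T *m (E *m v j)) (E *m u).
      by rewrite [RHS]dotcV_mull trmxK.
    rewrite -!mulmxA !mulNmx dotcVNl dotcVNr e -opprD -dotcVDl.
    have -> : A^T *m (E *m v j) + A *m (E *m v j) = phi j *: (E *m v j).
      rewrite !mulmxA cA cAT -mulmxDl -mulmxDr -mulmxA addrC eigA.
      by rewrite -scalemxAr.
    by rewrite dotcVZl mulNr.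
  by apply: is_derive_sumr => i; exact: is_deriveM.
have := linear_ode df s; rewrite /f => ->.
by rewrite expmx0 !mul1mx.
Qed.

(** The bilinear form of e^{-sA^T} e^{-sA} = e^{-s(A + A^T)}, and the source of every exponent phi_j
    below. *)
Lemma expmx_dot u w s :
  dotcV (expmx (s *: - A) *m u) (expmx (s *: - A) *m w) =
  \sum_j expR (- phi j * s) * dotcV (v j) w * dotcV (v j) u.
Proof.
rewrite {1}(orthonormal_expansion u) mulmx_sumr dotcV_suml.
apply: eq_bigr => j _.
by rewrite -scalemxAr dotcVZl expmx_eigen_dot mulrC.
Qed.

End spectral_family.

(** * Complex eigenvalues of A and those of its symmetric part *)

Section complex_eigenvalues.
Context {R : realType} {m : nat}.
Variables (v : 'I_m -> 'cV[R]_m) (A : 'M[R]_m) (phi : 'I_m -> R).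
Hypothesis ov : orthonormal_family v.
Hypothesis eigA : forall j, (A + A^T) *m v j = phi j *: v j.

Lemma Re_sum (I : Type) (s : seq I) (F : I -> R[i]) :
  complex.Re (\sum_(i <- s) F i) = \sum_(i <- s) complex.Re (F i).
Proof. by apply: big_morph => // -[a b] [c e]. Qed.

Lemma Im_sum (I : Type) (s : seq I) (F : I -> R[i]) :
  complex.Im (\sum_(i <- s) F i) = \sum_(i <- s) complex.Im (F i).
Proof. by apply: big_morph => // -[a b] [c e]. Qed.

(* For a complex left eigenvector x + iy,
   <x, A x> + <y, A y> = Re l (|x|^2 + |y|^2). *)
Lemma eigenvalue_Re_gt0 (l : R[i]) : (forall j, 0 < phi j) ->
  eigenvalue (cplxmx A) l -> 0 < complex.Re l.
Proof.
move=> phi0 /eigenvalueP[z zA z0].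
pose x : 'cV[R]_m := \col_i complex.Re (z ord0 i).
pose y : 'cV[R]_m := \col_i complex.Im (z ord0 i).
set a := complex.Re l; pose b := complex.Im l.
have Ax : A^T *m x = a *: x - b *: y.
  apply/colP => i.
  have h := congr1 (fun M : 'rV[R[i]]_m => complex.Re (M ord0 i)) zA.
  rewrite /= !mxE Re_sum in h; rewrite !mxE.
  transitivity (complex.Re (l * z ord0 i)).
    rewrite -h; apply: eq_bigr => j _; rewrite !mxE.
    by case: (z ord0 j) => p q; rewrite /= mulr0 subr0 mulrC.
  by rewrite /a /b; case: (l) => ? ?; case: (z ord0 i).
have Ay : A^T *m y = a *: y + b *: x.
  apply/colP => i.
  have h := congr1 (fun M : 'rV[R[i]]_m => complex.Im (M ord0 i)) zA.
  rewrite /= !mxE Im_sum in h; rewrite !mxE.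
  transitivity (complex.Im (l * z ord0 i)).
    rewrite -h; apply: eq_bigr => j _; rewrite !mxE.
    by case: (z ord0 j) => p q; rewrite /= mulr0 add0r mulrC.
  by rewrite /a /b; case: (l) => ? ?; case: (z ord0 i).
have E : dotcV x (A *m x) + dotcV y (A *m y) = a * (dotcV x x + dotcV y y).
  have tr w : dotcV w (A *m w) = dotcV w (A^T *m w).
    by rewrite dotcVC dotcV_mull.
  rewrite !tr Ax Ay dotcVBr dotcVDr !dotcVZr (dotcVC y x); ring.
have pos w : 0 <= dotcV w (A *m w).
  have [->|w0] := eqVneq w 0; first by rewrite dotcV0l.
  exact/ltW/(symmetric_part_posdef ov eigA).
(* Since z is nonzero, so is its real or its imaginary part. *)
have h : 0 < dotcV x (A *m x) + dotcV y (A *m y).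
  have [x0|x0] := eqVneq x 0; last first.
    by apply: ltr_pwDl => //; exact: (symmetric_part_posdef ov eigA).
  rewrite x0 dotcV0l add0r; apply: (symmetric_part_posdef ov eigA) => //.
  apply: contra z0 => /eqP y0; apply/eqP/rowP => i; rewrite mxE.
  have := congr1 (fun w : 'cV[R]_m => w i ord0) x0.
  have := congr1 (fun w : 'cV[R]_m => w i ord0) y0.
  by rewrite !mxE; case: (z ord0 i) => p q /= -> ->.
rewrite ltNge; apply/negP => a0; move: h; rewrite E ltNge => /negP; apply.
by rewrite mulr_le0_ge0// addr_ge0// dotcV_ge0.
Qed.

Lemma char_poly_similar (F : fieldType) (k : nat) (Q D : 'M[F]_k) : Q \in unitmx ->
  char_poly (invmx Q *m D *m Q) = char_poly D.
Proof.
move=> uQ; rewrite /char_poly.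
have -> : char_poly_mx (invmx Q *m D *m Q) =
    map_mx polyC (invmx Q) *m char_poly_mx D *m map_mx polyC Q.
  rewrite /char_poly_mx !map_mxM mulmxBr mulmxBl; congr (_ - _).
  by rewrite scalar_mxC -mulmxA -map_mxM mulVmx// map_mx1 mulmx1.
rewrite !det_mulmx mulrAC -det_mulmx -map_mxM mulVmx// map_mx1 det1 mul1r.
by [].
Qed.

Lemma char_poly_diag_mx (F : fieldType) (k : nat) (D : 'rV[F]_k) :
  char_poly (diag_mx D) = \prod_j ('X - (D ord0 j)%:P).
Proof.
rewrite char_poly_trig ?diag_mx_is_trig//.
by apply: eq_bigr => j _; rewrite !mxE eqxx mulr1n.
Qed.

Lemma char_poly_symmetric_part :
  char_poly (cplxmx (A + A^T)) = \prod_j ('X - (phi j)%:C%C%:P).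
Proof.
pose V : 'M[R]_m := \matrix_(i, j) v j i ord0.
have VV : V^T *m V = 1%:M.
  apply/matrixP => i j; rewrite !mxE -ov; apply: eq_bigr => l _.
  by rewrite !mxE.
have [uVT uV] := mulmx1_unit VV.
have VE : A + A^T = invmx V^T *m diag_mx (\row_j phi j) *m V^T.
  have iV : invmx V^T = V.
    by rewrite -[V in RHS]mul1mx -(mulVmx uVT) -mulmxA VV mulmx1.
  rewrite iV (symmetric_part_spectral ov eigA); apply/matrixP => i j.
  rewrite summxE !mxE; apply: eq_bigr => l _.
  rewrite mul_mx_diag !mxE big_ord1 !mxE; ring.
rewrite /cplxmx VE !map_mxM map_invmx map_diag_mx char_poly_similar; last first.
  by rewrite map_unitmx.
by rewrite char_poly_diag_mx; apply: eq_bigr => j _; rewrite !mxE.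
Qed.

(** The inverse of a unitary Q is its adjoint, so the adjoint of M is diagonalized by the same Q,
    with conjugate entries. *)
Lemma add_adjoint_diag (C : numClosedFieldType) (k : nat) (Q : 'M[C]_k)
    (D : 'rV[C]_k) : Q \is unitarymx ->
  let M := invmx Q *m diag_mx D *m Q in
  M + map_mx Num.conj M^T = invmx Q *m diag_mx (\row_j (2 * 'Re (D ord0 j))) *m Q.
Proof.
move=> uQ M; have iQ := invmx_unitary uQ.
rewrite /M iQ !trmx_mul !map_mxM/= trmxCK tr_diag_mx map_diag_mx mulmxA.
rewrite -mulmxDl -mulmxDr; congr (_ *m _ *m _).
apply/matrixP => i j; rewrite !mxE -mulrnDl; congr (_ *+ _).
by rewrite ReE mulrC divfK// pnatr_eq0.
Qed.

Hypothesis normalA : A *m A^T = A^T *m A.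

(** Unitary diagonalization of A by entries D_j also diagonalizes A + A^T, by 2 Re D_j. Unique
    factorization of the two characteristic polynomials identifies D with [l] and 2 Re D with [phi],
    up to order. *)
Lemma eigenvalues_symmetric_part (l : 'I_m -> R[i]) : eigenvalues_of A l ->
  perm_eq [seq phi j | j <- enum 'I_m] [seq 2 * complex.Re (l j) | j <- enum 'I_m].
Proof.
move=> lA; set M := cplxmx A.
have Mt : map_mx Num.conj M^T = cplxmx A^T.
  by apply/matrixP => i j; rewrite !mxE; apply/eqP; rewrite eq_complex /= oppr0 !eqxx.
have nM : M \is normalmx.
  by apply/normalmxP; rewrite Mt /M /cplxmx -!map_mxM normalA.
have /orthomx_spectral_subproof[[Q D] /= uQ QM] := nM.
have unQ := unitarymx_unit uQ.
have prodE (f : 'I_m -> R[i]) :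
    \prod_(x <- [seq f j | j <- enum 'I_m]) ('X - x%:P) = \prod_j ('X - (f j)%:P).
  by rewrite big_map big_enum.
have lD : perm_eq [seq l j | j <- enum 'I_m] [seq D ord0 j | j <- enum 'I_m].
  apply: prod_XsubC_eq; rewrite !prodE -lA -/M QM char_poly_similar//.
  exact: char_poly_diag_mx.
have SE : cplxmx (A + A^T) = invmx Q *m diag_mx (\row_j (2 * 'Re (D ord0 j))) *m Q.
  rewrite -(add_adjoint_diag D uQ) -QM Mt.
  exact: map_mxD.
have pD : perm_eq [seq (phi j)%:C%C | j <- enum 'I_m]
   [seq 2 * 'Re (D ord0 j) | j <- enum 'I_m].
  apply: prod_XsubC_eq; rewrite !prodE.
  rewrite -char_poly_symmetric_part SE char_poly_similar// char_poly_diag_mx.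
  by apply: eq_bigr => j _; rewrite mxE.
have pR : perm_eq [seq phi j | j <- enum 'I_m]
   [seq 2 * complex.Re (D ord0 j) | j <- enum 'I_m].
  have -> : [seq phi j | j <- enum 'I_m] =
      map (@complex.Re R) [seq (phi j)%:C%C | j <- enum 'I_m].
    by rewrite -[RHS]map_comp.
  have -> : [seq 2 * complex.Re (D ord0 j) | j <- enum 'I_m] =
      map (@complex.Re R) [seq 2 * 'Re (D ord0 j) | j <- enum 'I_m].
    rewrite -[RHS]map_comp; apply: eq_map => j /=; rewrite -complexRe.
    by rewrite !mulr_natl !mulr2n.
  exact: perm_map.
apply: perm_trans pR _; rewrite perm_sym.
have := perm_map (fun z : R[i] => 2 * complex.Re z) lD.
by rewrite -!map_comp.
Qed.

(** Two sorted lists that are permutations of each other coincide. *)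
Lemma eigenvalues_symmetric_partE (l : 'I_m -> R[i]) : eigenvalues_of A l ->
  (forall i j : 'I_m, (i <= j)%N -> phi i <= phi j) ->
  (forall i j : 'I_m, (i <= j)%N -> complex.Re (l i) <= complex.Re (l j)) ->
  forall j, phi j = 2 * complex.Re (l j).
Proof.
move=> lA phi_le l_le j.
have srt (f : 'I_m -> R) : (forall i j : 'I_m, (i <= j)%N -> f i <= f j) ->
    sorted <=%O [seq f j | j <- enum 'I_m].
  move=> f_le; apply: (@homo_sorted _ _ f (fun i j : 'I_m => (i <= j)%N)) => //.
  have := iota_sorted 0 m; rewrite -val_enum_ord sorted_map.
  by [].
have l2_le (i k : 'I_m) : (i <= k)%N -> 2 * complex.Re (l i) <= 2 * complex.Re (l k).
  by move=> ik; rewrite ler_pM2l// l_le.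
have /eq_in_map -> // := le_sorted_eq (srt _ phi_le) (srt _ l2_le)
  (eigenvalues_symmetric_part lA).
by rewrite mem_enum.
Qed.

End complex_eigenvalues.

(** * The stationary covariance in the basis v_j *)

Section stationary_covariance.
Context {R : realType}.
Local Notation leb := (@lebesgue_measure R).

Lemma integral_expR_decay (k : R) : 0 < k ->
  (\int[leb]_(x in `[0%R, +oo[) (expR (- k * x))%:E = (k^-1)%:E)%E.
Proof.
move=> k0; pose F (x : R) := - (k^-1 * expR (- k * x)).
have dF (x : R) : is_derive x 1 F (expR (- k * x)).
  rewrite /F; apply: is_derive_eq; rewrite /GRing.scale/= !mulr1.
  by field; rewrite gt_eqF.
have cf : continuous (fun x : R => expR (- k * x)).
  move=> x; apply: continuous_comp; last exact: continuous_expR.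
  by apply: cvgM; [exact: cvg_cst|exact: cvg_id].
rewrite (@ge0_continuous_FTC2y R _ F 0 0).
- by rewrite /F mulr0 expR0 mulr1 -EFinB sub0r opprK.
- by move=> x _; exact: expR_ge0.
- exact: continuous_subspaceT.
- rewrite /F -[X in _ --> X]oppr0 -[X in _ --> - X](mulr0 k^-1).
  apply: cvgN; apply: cvgM; first exact: cvg_cst.
  rewrite (_ : (fun x => expR (- k * x)) =
               (fun z => expR (- z)) \o (fun z => k * z)); last first.
    by apply: eq_fun => x; rewrite mulNr.
  apply: (@cvg_comp _ _ _ _ _ _ (pinfty_nbhs R)); last exact: cvgr_expR.
  exact: gt0_cvgMry.
- by move=> x _; have [] := dF x.
- apply: cvg_at_right_filter; rewrite /F; apply: cvgN; apply: cvgM; first exact: cvg_cst.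
  exact: cf.
- by move=> x _; rewrite derive1E; have /@derive_val -> := dF x.
Qed.

Lemma integrable_expR_decay (k : R) : 0 < k ->
  leb.-integrable `[0, +oo[ (EFin \o (fun x => expR (- k * x))).
Proof.
move=> k0; apply/integrableP; split.
  apply/measurable_EFinP/measurable_funTS.
  by apply: measurableT_comp => //; exact: measurable_funM.
under eq_integral do rewrite /= ger0_norm ?expR_ge0//.
by rewrite integral_expR_decay// ltry.
Qed.

Lemma Rintegral_sumr d (T : measurableType d) (mu : {measure set T -> \bar R})
    (D : set T) (I : Type) (s : seq I) (f : I -> T -> R) : measurable D ->
  (forall i, mu.-integrable D (EFin \o f i)) ->
  mu.-integrable D (EFin \o (fun x => \sum_(i <- s) f i x)) /\
  \int[mu]_(x in D) (\sum_(i <- s) f i x) = \sum_(i <- s) \int[mu]_(x in D) f i x.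
Proof.
move=> mD fi; elim: s => [|i s [IH1 IH2]].
  rewrite big_nil (_ : (fun x => _) = fun=> 0); last first.
    by apply/funext => x; rewrite big_nil.
  split; first exact: integrable0.
  by rewrite /Rintegral integral0.
rewrite big_cons (_ : (fun x => _) = fun x => f i x + \sum_(i <- s) f i x); last first.
  by apply/funext => x; rewrite big_cons.
split; last by rewrite RintegralD// IH2.
rewrite [X in _.-integrable _ X](_ : _ =
  (fun x => (f i x)%:E + (\sum_(i <- s) f i x)%:E)%E)//.
exact: (integrableD mD (fi i) IH1).
Qed.

Context {m n : nat}.
Variables (v : 'I_m -> 'cV[R]_m) (A : 'M[R]_m) (phi : 'I_m -> R).
Variable sigma : 'M[R]_(m, n).
Hypothesis ov : orthonormal_family v.
Hypothesis normalA : A *m A^T = A^T *m A.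
Hypothesis eigA : forall j, (A + A^T) *m v j = phi j *: v j.
Hypothesis phi0 : forall j, 0 < phi j.
Hypothesis hsigma : sigma *m sigma^T = 1%:M.

Lemma stationary_covE : stationary_cov A sigma = spectral_mx v (fun j => (phi j)^-1).
Proof.
have eigAT j : (A^T + A^T^T) *m v j = phi j *: v j by rewrite trmxK addrC eigA.
have normalAT : A^T *m A^T^T = A^T^T *m A^T by rewrite trmxK normalA.
apply/matrixP => i j; rewrite mxE.
pose c k := (v k) i ord0 * (v k) j ord0.
(* Once sigma sigma^T is removed, the entry is <e^{-sA^T} e_i, e^{-sA^T} e_j> for the standard basis
   e_i. So [expmx_dot] is applied to A^T, again normal and with the same symmetric part. *)
have E s : (expmx (- s *: A) *m sigma *m sigma^T *m expmx (- s *: A^T)) i j =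
    \sum_k c k * expR (- phi k * s).
  rewrite -(mulmxA (expmx _) sigma) hsigma mulmx1.
  pose F := expmx (s *: - A^T).
  have -> : expmx (- s *: A^T) = F by rewrite scaleNr -scalerN.
  have -> : expmx (- s *: A) = F^T by rewrite expmx_tr raddfN/= trmxK scaleNr -scalerN.
  transitivity (dotcV (F *m delta_mx i ord0) (F *m delta_mx j ord0)).
    by rewrite dotcV_mull dotcV_delta mulmxA -colE [RHS]mxE.
  rewrite (expmx_dot ov normalAT eigAT); apply: eq_bigr => k _.
  by rewrite !(dotcVC (v k)) !dotcV_delta /c; ring.
under eq_Rintegral do rewrite E.
have intk k : leb.-integrable `[0, +oo[ (EFin \o (fun s => c k * expR (- phi k * s))).
  rewrite [X in _.-integrable _ X](_ : _ = (fun s => (c k)%:E * (expR (- phi k * s))%:E)%E)//.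
  by apply: integrableZl => //; exact: integrable_expR_decay.
have [//|_ ->] := @Rintegral_sumr _ (measurableTypeR R) leb `[0, +oo[%classic _
  (index_enum 'I_m) (fun k s => c k * expR (- phi k * s)) _ intk.
rewrite summxE; apply: eq_bigr => k _.
rewrite RintegralZl//; last exact: integrable_expR_decay.
by rewrite /Rintegral integral_expR_decay// /= !mxE big_ord1 mxE /c mulrC.
Qed.

End stationary_covariance.

(** * Riemann and Riemann-Stieltjes sums on a uniform grid *)

Section riemann_sums.
Context {R : realType}.
Local Notation leb := (@lebesgue_measure R).
Implicit Types (f g : R -> R) (t : R).

Lemma itv_uniform_continuity g t : {within `[0, t], continuous g} ->
  forall e, 0 < e -> exists2 r, 0 < r & forall x y, x \in `[0, t] -> y \in `[0, t] ->
    `|x - y| < r -> `|g x - g y| < e.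
Proof.
move=> /subspace_continuousP cg e e0.
pose P (r x : R) := x \in `[0, t] ->
  forall y, y \in `[0, t] -> `|x - y| < r -> `|g x - g y| < e.
(* Heine's theorem from the near-covering form of compactness: radii that work near each point yield
   one radius for the whole interval. *)
have /compact_near_coveringP/(_ _ (0^'+) P _) := @segment_compact R 0 t.
have nc (x : R) : `[0, t]%classic x -> \forall x' \near x & r \near (0 : R)^'+, P r x'.
  move=> xt; have /cvgrPdist_lt/(_ (e / 2)) := cg x xt.
  rewrite divr_gt0// => /(_ isT); rewrite near_withinE => /nbhs_ballP[q /= q0 hq].
  have q20 : 0 < q / 2 by rewrite divr_gt0.
  have hx z : `|x - z| < q -> z \in `[0, t] -> `|g x - g z| < e / 2.
    by move=> xz zt; exact: (hq z xz zt).
  near=> x' r => x't y yt x'y.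
  have xx' : `|x - x'| < q / 2.
    near: x'; exact: (nbhsx_ballx x (q / 2) q20).
  have rq : r < q / 2 by near: r; exact: nbhs_right_lt.
  rewrite (splitr e) (le_lt_trans (ler_distD (g x) _ _))// ltrD//.
    by rewrite distrC; apply: hx => //; rewrite (lt_trans xx')// ltr_pdivrMr// ltr_pMr// ltr1n.
  apply: hx => //; rewrite (le_lt_trans (ler_distD x' _ _))// (splitr q) ltrD//.
  exact: lt_trans x'y rq.
move=> /(_ nc) [r /= r0 h]; exists (r / 2); first by rewrite divr_gt0.
move=> x y xt yt xy; apply: (h (r / 2)) => //=.
  by rewrite sub0r normrN ger0_norm ?divr_ge0 ?(ltW r0)// ltr_pdivrMr// ltr_pMr// ltr1n.
by rewrite divr_gt0.
Unshelve. all: by end_near. Qed.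

Lemma itv_bounded g t : {within `[0, t], continuous g} ->
  exists2 M, 0 <= M & forall x, x \in `[0, t] -> `|g x| <= M.
Proof.
move=> cg; have [t0|t0] := leP 0 t; last first.
  exists 0 => // x; rewrite in_itv/= => /andP[x0 xt].
  by have := le_lt_trans (le_trans x0 xt) t0; rewrite ltxx.
have cn : {within `[0, t], continuous (fun x => `|g x|)}.
  by move=> x; apply: continuous_comp; [exact: cg|exact: norm_continuous].
have [c ct cM] := EVT_max t0 cn.
by exists `|g c|.
Qed.

Lemma Rintegral_itv_step g (a b t c e : R) : 0 <= a -> a <= b -> b <= t ->
  {within `[0, t], continuous g} -> (forall s, s \in `[a, b] -> `|g s - c| <= e) ->
  `|\int[leb]_(s in `[0, b]) g s - \int[leb]_(s in `[0, a]) g s - c * (b - a)|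
     <= e * (b - a).
Proof.
move=> a0 ab bt cg he.
have cgb : {within `[0, b], continuous g}.
  apply: continuous_subspaceW cg => x /=; rewrite !in_itv/= => /andP[-> /=].
  by move=> /le_trans -> .
have ib : leb.-integrable `[0, b] (EFin \o g).
  by apply: continuous_compact_integrable => //; exact: segment_compact.
rewrite Rintegral_itvB//.
have sub : `]a, b]%classic `<=` `[0, b]%classic.
  move=> x /=; rewrite !in_itv/= => /andP[ax ->]; rewrite andbT.
  by rewrite (le_trans a0)// ltW.
have iab : leb.-integrable `]a, b] (EFin \o g).
  by apply: integrableS ib => //.
have leab : fine (leb `]a, b]) = b - a.
  rewrite lebesgue_measure_itv/= lte_fin; move: ab; rewrite le_eqVlt.
  by move=> /predU1P[->|->//]; rewrite ltxx subrr.
have icst k : leb.-integrable `]a, b] (EFin \o (fun=> k)).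
  apply: (@integrableS _ _ _ leb `[a, b]) => //.
    by move=> x /=; rewrite !in_itv/= => /andP[/ltW -> ->].
  apply: continuous_compact_integrable; first exact: segment_compact.
  by apply: continuous_subspaceT => x; exact: cvg_cst.
have -> : c * (b - a) = \int[leb]_(s in `]a, b]) c by rewrite Rintegral_cst// leab.
rewrite -RintegralB//.
have igc : leb.-integrable `]a, b] (EFin \o (fun s => g s - c)).
  rewrite [X in _.-integrable _ X](_ : _ = (fun s => (g s)%:E - c%:E)%E)//.
  exact: (integrableB _ iab (icst c)).
rewrite (le_trans (le_normr_Rintegral _ igc))//.
have -> : e * (b - a) = \int[leb]_(s in `]a, b]) e by rewrite Rintegral_cst// leab.
apply: le_Rintegral => //.
- exact: (integrable_norm igc).
- move=> x; rewrite /= in_itv/= => /andP[ax xb]; apply: he.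
  by rewrite in_itv/= (ltW ax).
Qed.

(* Riemann-Stieltjes sums of g against f and Riemann sums of f' against the
   primitive of g agree up to o(1), by uniform continuity of f' and g. *)
Lemma riemann_sum_error f df g t : 0 <= t ->
  (forall s : R, is_derive s 1 f (df s)) -> continuous df ->
  {within `[0, t], continuous g} ->
  let p N i : R := i%:R * (t / N.+1%:R) in
  let J s := \int[leb]_(r in `[0, s]) g r in
  (fun N : nat => \sum_(0 <= i < N.+1)
     ((f (p N i.+1) - f (p N i)) * g (p N i.+1)
      - df (p N i) * (J (p N i.+1) - J (p N i)))) @ \oo --> 0.
Proof.
move=> t0 fd cdf cg p J.
have cdft : {within `[0, t], continuous df} by exact: continuous_subspaceT.
have [M M0 gM] := itv_bounded cg; have [K K0 dfK] := itv_bounded cdft.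
apply/cvgrPdist_le => /= e e0.
(* Each of the N + 1 cells contributes at most e' h (M + K), in total e' (M + K) t; the added 1
   keeps the denominator positive. *)
pose e' := e / ((M + K) * t + 1).
have S0 : 0 < (M + K) * t + 1 by rewrite ltr_wpDl// mulr_ge0// addr_ge0.
have e'0 : 0 < e' by rewrite divr_gt0.
have [r1 r10 gu] := itv_uniform_continuity cg e'0.
have [r2 r20 dfu] := itv_uniform_continuity cdft e'0.
near=> N.
set h := t / N.+1%:R.
have h0 : 0 <= h by rewrite divr_ge0.
have hr : h < Num.min r1 r2.
  rewrite /h ltr_pdivrMr// mulrC -ltr_pdivrMr ?lt_min ?r10//.
  apply: (@lt_trans _ _ N%:R); last by rewrite ltr_nat.
  by near: N; exact: nbhs_infty_gtr.
have /andP[h1 h2] : (h < r1) && (h < r2) by rewrite -lt_min.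
have pS i : p N i.+1 - p N i = h by rewrite /p -/h -mulrBl -natrB// subSnn mul1r.
have p0 i : 0 <= p N i by rewrite /p mulr_ge0.
have pt i : (i <= N.+1)%N -> p N i <= t.
  move=> iN; rewrite /p mulrCA ler_piMr// ler_pdivrMr// mul1r ler_nat//.
have step i : (i < N.+1)%N ->
   `|(f (p N i.+1) - f (p N i)) * g (p N i.+1)
      - df (p N i) * (J (p N i.+1) - J (p N i))| <= e' * h * (M + K).
  move=> iN; set a := p N i; set b := p N i.+1.
  have a0 : 0 <= a by exact: p0.
  have bt : b <= t by exact: pt.
  have ab : a <= b by rewrite -subr_ge0 pS.
  have inab s : s \in `[a, b] -> [/\ s \in `[0, t], `|s - a| <= h & `|b - s| <= h].
    rewrite !in_itv/= => /andP[as_ sb]; split.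
    - by rewrite (le_trans a0)//= (le_trans sb).
    - by rewrite ger0_norm ?subr_ge0// -(pS i) lerD2r.
    - by rewrite ger0_norm ?subr_ge0// -(pS i) lerB.
  have at_ : a \in `[0, t] by rewrite in_itv/= a0 (le_trans ab).
  have bt_ : b \in `[0, t] by rewrite in_itv/= bt (le_trans a0).
  have F : `|f b - f a - df a * h| <= e' * h.
    (* The mean value theorem needs a < b; the cell is degenerate when t = 0. *)
    move: ab; rewrite le_eqVlt => /predU1P[ab|ab].
      have hz : h = 0 by rewrite -(pS i) -/a -/b ab subrr.
      by rewrite hz ab subrr !mulr0 subrr normr0.
    have cf : {within `[a, b], continuous f}.
      apply: continuous_subspaceT => s.
      by apply: differentiable_continuous; apply/derivable1_diffP; have [] := fd s.
    have [c cab ->] := MVT ab (fun x _ => fd x) cf.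
    rewrite (pS i) -mulrBl normrM [`|h|]ger0_norm// ler_wpM2r//.
    have [ct ca _] := inab c (subset_itv_oo_cc cab).
    by apply/ltW/dfu => //; exact: le_lt_trans ca h2.
  have G : `|J b - J a - g b * h| <= e' * h.
    rewrite -(pS i); apply: (Rintegral_itv_step a0 ab bt cg) => s sab.
    have [st _ sb] := inab s sab.
    by rewrite distrC; apply/ltW/gu => //; exact: le_lt_trans sb h1.
  (* Both products are compared with df(a) g(b) h: f is linearized at the left end, the primitive of
     g at the right end. *)
  rewrite (_ : _ - _ = (f b - f a - df a * h) * g b - df a * (J b - J a - g b * h)); last by ring.
  rewrite (mulrDr (e' * h)) (le_trans (ler_normB _ _))// !normrM lerD//.
    by rewrite ler_pM// gM.
  by rewrite [leRHS]mulrC ler_pM// dfK.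
rewrite sub0r normrN (le_trans (ler_norm_sum _ _ _))//.
apply: (@le_trans _ _ (\sum_(0 <= i < N.+1) e' * h * (M + K))).
  by rewrite !big_nat; apply: ler_sum => i /andP[_ iN]; exact: step.
rewrite sumr_const_nat subn0 -mulr_natr.
have hN : h * N.+1%:R = t by rewrite /h divfK ?pnatr_eq0.
have -> : e' * h * (M + K) * N.+1%:R = e' * ((M + K) * (h * N.+1%:R)) by ring.
rewrite hN.
rewrite /e' mulrAC ler_pdivrMr// ler_wpM2l ?(ltW e0)//.
by rewrite lerDl.
Unshelve. all: by end_near. Qed.

Definition grid (t : R) (N i : nat) : R := i%:R * (t / N.+1%:R).

Lemma grid0 t N : grid t N 0 = 0.
Proof. by rewrite /grid mul0r. Qed.

Lemma grid_last t N : grid t N N.+1 = t.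
Proof. by rewrite /grid mulrC divfK ?pnatr_eq0. Qed.

Lemma gridS t N i : grid t N i.+1 - grid t N i = t / N.+1%:R.
Proof. by rewrite /grid -mulrBl -natrB// subSnn mul1r. Qed.

Lemma grid_ge0 t N i : 0 <= t -> 0 <= grid t N i.
Proof. by move=> t0; rewrite /grid mulr_ge0// divr_ge0. Qed.

Lemma grid_homo t N i j : 0 <= t -> (i <= j)%N -> grid t N i <= grid t N j.
Proof. by move=> t0 ij; rewrite ler_wpM2r ?divr_ge0// ler_nat. Qed.

(** [riemann_sum_error] with g = 1: the Stieltjes sums of an antiderivative telescope to the value
    of the integral, and the Riemann sums differ from them by o(1). *)
Lemma cvg_riemann_sum_expR (k t : R) : 0 <= t -> k != 0 ->
  (fun N : nat => \sum_(0 <= i < N.+1)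
     expR (- k * (t - grid t N i)) * (t / N.+1%:R)) @ \oo -->
  (1 - expR (- k * t)) / k.
Proof.
move=> t0 k0.
pose f (s : R) := k^-1 * expR (- k * (t - s)).
have fd (s : R) : is_derive s 1 f (expR (- k * (t - s))).
  rewrite /f; apply: is_derive_eq; rewrite /GRing.scale/= !(mulr0, mulr1, add0r, addr0).
  by field.
have cdf : continuous (fun s : R => expR (- k * (t - s))).
  move=> s; apply: continuous_comp; last exact: continuous_expR.
  apply: cvgM; first exact: cvg_cst.
  by apply: cvgB; [exact: cvg_cst|exact: cvg_id].
have c1 : {within `[0, t], continuous (fun=> 1 : R)}.
  by apply: continuous_subspaceT => s; exact: cvg_cst.
have := riemann_sum_error t0 fd cdf c1.
have J s : 0 <= s -> \int[leb]_(r in `[0, s]) 1 = s.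
  move=> s0; have lebs : fine (leb `[0, s]) = s.
    rewrite lebesgue_measure_itv/= lte_fin; move: s0; rewrite le_eqVlt => /predU1P[<-|->].
      by rewrite ltxx.
    by rewrite /= oppr0 addr0.
  by rewrite Rintegral_cst// mul1r lebs.
move=> /= h.
have : (fun N : nat => (f t - f 0) - \sum_(0 <= i < N.+1)
    ((f (grid t N i.+1) - f (grid t N i)) * 1 - expR (- k * (t - grid t N i)) *
      (\int[leb]_(r in `[0, grid t N i.+1]) 1 - \int[leb]_(r in `[0, grid t N i]) 1)))
   @ \oo --> f t - f 0 - 0 by apply: cvgB; [exact: cvg_cst|exact: h].
have -> : f t - f 0 - 0 = (1 - expR (- k * t)) / k.
  by rewrite /f subrr !subr0 mulr0 expR0; field.
apply: cvg_trans; apply: near_eq_cvg; apply: nearW => N.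
rewrite sumrB (eq_bigr (fun i => f (grid t N i.+1) - f (grid t N i))); last first.
  by move=> i _; rewrite mulr1.
rewrite telescope_sumr// grid0 grid_last opprB addrCA subrr addr0.
by apply: eq_bigr => i _; rewrite !J ?grid_ge0// gridS.
Qed.

End riemann_sums.

(** * Summation by parts along the path of a linear integral equation *)

Section linear_path.
Context {R : realType} {m : nat}.
Local Notation leb := (@lebesgue_measure R).
Variables (M : 'M[R]_m) (D beta W : R -> 'cV[R]_m) (D0 : 'cV[R]_m) (t : R).
Hypothesis t0 : 0 <= t.
Hypothesis cD : forall k, {within `[0, t], continuous (fun s => D s k ord0)}.
Hypothesis DE : forall s, 0 <= s -> s <= t -> D s = D0
  - (\col_i \int[leb]_(r in `[0, s]) (M *m D r) i ord0) + beta s.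
Hypothesis dW : forall k (s : R), is_derive s 1 (fun s => W s k ord0) ((M^T *m W s) k ord0).

(* Summation by parts: W' = M^T W cancels the drift of D. *)
Lemma cvg_stieltjes_sum :
  (fun N : nat => \sum_(0 <= i < N.+1)
     dotcV (W (grid t N i)) (beta (grid t N i.+1) - beta (grid t N i))) @ \oo -->
  dotcV (W t) (D t) - dotcV (W 0) (D 0).
Proof.
pose J k s := \int[leb]_(r in `[0, s]) D r k ord0.
have cDs k s : s <= t -> {within `[0, s], continuous (fun r => D r k ord0)}.
  move=> st; have := @cD k; apply: continuous_subspaceW => x /=.
  by rewrite !in_itv/= => /andP[-> /le_trans ->].
have iD k s : s <= t -> leb.-integrable `[0, s] (EFin \o (fun r => D r k ord0)).
  move=> st; apply: continuous_compact_integrable; first exact: segment_compact.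
  exact: cDs.
have JE i s : s <= t -> \int[leb]_(r in `[0, s]) (M *m D r) i ord0 =
    (M *m (\col_k J k s)) i ord0.
  move=> st; rewrite mxE.
  transitivity (\int[leb]_(r in `[0, s]) \sum_k M i k * D r k ord0).
    by apply: eq_Rintegral => r _; rewrite mxE.
  have iMD k : leb.-integrable `[0, s] (EFin \o (fun r => M i k * D r k ord0)).
    rewrite [X in _.-integrable _ X](_ : _ = (fun r => (M i k)%:E * (D r k ord0)%:E)%E)//.
    by apply: integrableZl => //; exact: iD.
  have [//|_ ->] := @Rintegral_sumr _ _ (measurableTypeR R) leb `[0, s]%classic _
    (index_enum 'I_m) (fun k r => M i k * D r k ord0) _ iMD.
  by apply: eq_bigr => k _; rewrite RintegralZl ?mxE//; exact: iD.
have cW k : continuous (fun s => W s k ord0).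
  move=> s; apply: differentiable_continuous; apply/derivable1_diffP.
  by have [] := dW k s.
have cMW k : continuous (fun s => (M^T *m W s) k ord0).
  rewrite (_ : (fun s => _) = fun s => \sum_l M^T k l * W s l ord0); last first.
    by apply/funext => s; rewrite mxE.
  move=> s; elim: (index_enum 'I_m) => [|l r IH].
    rewrite (_ : (fun _ => _) = fun=> 0); first exact: cvg_cst.
    by apply/funext => y; rewrite big_nil.
  rewrite (_ : (fun _ => _) =
      fun y => M^T k l * W y l ord0 + \sum_(j <- r) M^T k j * W y j ord0).
    by apply: cvgD IH; apply: cvgM; [exact: cvg_cst|exact: cW].
  by apply/funext => y; rewrite big_cons.
(* What the telescoping sum of <W, D> leaves over; coordinate by coordinate it is the error of
   [riemann_sum_error], with f = W_k and g = D_k. *)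
pose err N := \sum_(0 <= i < N.+1) \sum_k
  ((W (grid t N i.+1) k ord0 - W (grid t N i) k ord0) * D (grid t N i.+1) k ord0
   - (M^T *m W (grid t N i)) k ord0 * (J k (grid t N i.+1) - J k (grid t N i))).
have err0 : err @ \oo --> 0.
  suff : err @ \oo --> \sum_(k < m) (0 : R) by rewrite big1.
  rewrite /err; under eq_fun do rewrite exchange_big/=.
  by apply: cvg_sumr => k; exact: (riemann_sum_error t0 (dW k) (cMW k) (@cD k)).
have : (fun N => dotcV (W t) (D t) - dotcV (W 0) (D 0) - err N) @ \oo -->
    dotcV (W t) (D t) - dotcV (W 0) (D 0) - 0.
  by apply: cvgB => //; exact: cvg_cst.
rewrite subr0; apply: cvg_trans; apply: near_eq_cvg; apply: nearW => N.
rewrite /err.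
have -> : dotcV (W t) (D t) - dotcV (W 0) (D 0) = \sum_(0 <= i < N.+1)
    (dotcV (W (grid t N i.+1)) (D (grid t N i.+1)) - dotcV (W (grid t N i)) (D (grid t N i))).
  by rewrite telescope_sumr// grid0 grid_last.
rewrite -sumrB; rewrite !big_nat; apply: eq_bigr => i /andP[_ iN].
set a := grid t N i; set b := grid t N i.+1.
have a0 : 0 <= a by exact: grid_ge0.
have b0 : 0 <= b by exact: grid_ge0.
have bt : b <= t by rewrite -[leRHS](grid_last t N); exact: grid_homo.
have at_ : a <= t by rewrite -[leRHS](grid_last t N); apply: grid_homo => //; exact: ltnW.
have bE s : 0 <= s -> s <= t -> beta s = D s - D0 + M *m (\col_k J k s).
  move=> s0 st; rewrite [in RHS]DE//.
  have -> : M *m (\col_k J k s) = \col_i \int[leb]_(r in `[0, s]) (M *m D r) i ord0.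
    by apply/colP => l; rewrite [RHS]mxE JE.
  by move: (\col_i _) => C; apply/colP => l; rewrite !mxE; ring.
rewrite (bE _ b0 bt) (bE _ a0 at_).
have -> : \sum_k ((W b k ord0 - W a k ord0) * D b k ord0 -
      (M^T *m W a) k ord0 * (J k b - J k a)) =
    dotcV (W b - W a) (D b) - dotcV (M^T *m W a) ((\col_k J k b) - (\col_k J k a)).
  by rewrite /dotcV -sumrB; apply: eq_bigr => k _; rewrite !mxE.
(* Moving M across gives <W a, M (J b - J a)>, exactly the drift part of the increment of [beta]. *)
rewrite [dotcV (M^T *m _) _]dotcV_mull trmxK mulmxBr !(dotcVDr, dotcVNr, dotcVDl, dotcVNl).
by ring.
Qed.

End linear_path.

Lemma fine_lebesgue_itv0 {R : realType} (s : R) : 0 <= s ->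
  fine (lebesgue_measure `[0, s]) = s.
Proof.
rewrite lebesgue_measure_itv/= lte_fin le_eqVlt => /predU1P[<-|->].
  by rewrite ltxx.
by rewrite /= oppr0 addr0.
Qed.

(** * The law of X_t *)

Section ornstein_uhlenbeck.
Context {R : realType} {m n : nat}.
Local Notation leb := (@lebesgue_measure R).
Variables (A : 'M[R]_m) (sigma : 'M[R]_(m, n)) (b : 'cV[R]_n).
Context {d : measure_display} {Omega : measurableType d}.
Variables (P : probability Omega R) (B : R -> {RV P >-> 'cV[R]_n}).
Hypothesis hsigma : sigma *m sigma^T = 1%:M.
Hypothesis hB : brownian_motion B.

Lemma measurable_increment s t : measurable_fun setT (fun w => B t w - B s w).
Proof.
apply: measurable_vec => i.
rewrite (_ : (fun w => _) = fun w => B t w i ord0 - B s w i ord0); last first.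
  by apply/funext => w; rewrite !mxE.
by apply: measurable_funB; apply: (measurableT_comp (measurable_coord i)).
Qed.

Lemma increments_cos (s : nat -> R) (k : nat) (p : nat -> 'cV[R]_n) c : 0 <= s 0%N ->
  {homo s : i j / (i <= j)%N >-> i <= j} ->
  \int[P]_w cos (\sum_(0 <= i < k) dotcV (p i) (B (s i.+1) w - B (s i) w) + c) =
  (\prod_(0 <= i < k) normal_char ((s i.+1 - s i) * dotcV (p i) (p i))) * cos c.
Proof.
move=> s0 hs; have [_ _ lawB indB] := hB.
have s_ge0 i : 0 <= s i by apply: le_trans s0 (hs _ _ _).
have := @independent_normal_cos _ _ _ P n k
  (fun i w => B (s i.+1) w - B (s i) w) (fun i => (s i.+1 - s i)%:M)
  (fun i => measurable_increment _ _) (indB k s s0 hs) _ p c.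
move=> ->; last by move=> i; apply: lawB => //; exact: hs.
by congr (_ * _); apply: eq_bigr => i _; rewrite mul_scalar_mx dotcVZr.
Qed.

(* B_(x + y) - B_0 is the sum of two independent increments. *)
Lemma normal_charD x y : (0 < n)%N -> 0 <= x -> 0 <= y ->
  normal_char (x + y) = normal_char x * normal_char y :> R.
Proof.
move=> n0 x0 y0; pose e : 'cV[R]_n := delta_mx (Ordinal n0) ord0.
have ee : dotcV e e = 1 by rewrite dotcV_delta mxE !eqxx.
(* The times 0, x, x + y, continued constantly so as to form a monotone sequence. *)
pose s (i : nat) : R := if i is 0%N then 0 else if i is 1%N then x else x + y.
have hs : {homo s : i j / (i <= j)%N >-> i <= j}.
  by move=> [|[|i]] [|[|j]] //= _; rewrite ?addr_ge0// lerDl.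
have h2 := increments_cos 2 (fun=> e) 0 (lexx _ : 0 <= s 0%N) hs.
pose s' (i : nat) : R := if i is 0%N then 0 else x + y.
have hs' : {homo s' : i j / (i <= j)%N >-> i <= j}.
  by move=> [|i] [|j] //= _; rewrite ?addr_ge0.
have h1 := increments_cos 1 (fun=> e) 0 (lexx _ : 0 <= s' 0%N) hs'.
move: h1 h2; rewrite !big_nat1 !cos0 !mulr1 ee !subr0 !mulr1 => <-.
rewrite big_nat_recr//= big_nat1 /= !mulr1 subr0 [x + y]addrC addrK => <-.
apply: eq_Rintegral => w _; congr (cos (_ + _)).
by rewrite big_nat1 big_nat_recr//= big_nat1 !dotcVBr; ring.
Qed.

Lemma normal_char_sum (k : nat) (h : R) (p : nat -> 'cV[R]_n) : 0 <= h ->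
  \prod_(0 <= i < k) normal_char (h * dotcV (p i) (p i)) =
  normal_char (\sum_(0 <= i < k) h * dotcV (p i) (p i)).
Proof.
move=> h0; case: (posnP n) => n0.
  (* For n = 0 there is no unit vector to test the Brownian motion with, but all the variances are
     0. *)
  have p0 i : dotcV (p i) (p i) = 0.
    by rewrite /dotcV big1// => j _; move: (ltn_ord j); rewrite [X in (_ < X)%N]n0.
  rewrite !big1 ?normal_char0// => i _; rewrite p0 mulr0//.
  by rewrite normal_char0.
elim: k => [|k IH]; first by rewrite !big_geq// normal_char0.
rewrite !big_nat_recr//= IH normal_charD//.
  by apply: sumr_ge0 => i _; rewrite mulr_ge0// dotcV_ge0.
by rewrite mulr_ge0// dotcV_ge0.
Qed.

Variables (v : 'I_m -> 'cV[R]_m) (phi : 'I_m -> R).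
Hypothesis ov : orthonormal_family v.
Hypothesis normalA : A *m A^T = A^T *m A.
Hypothesis eigA : forall j, (A + A^T) *m v j = phi j *: v j.
Hypothesis phi0 : forall j, 0 < phi j.
Variables (x : 'cV[R]_m) (X : R -> {RV P >-> 'cV[R]_m}).
Hypothesis hX : sde_solution A sigma (fun t w => B t w + t *: b) x X.
Variable t : R.
Hypothesis t0 : 0 <= t.

(** The rest point of the drift, A c = sigma b, and the mean of the limiting law. *)
Definition ou_center : 'cV[R]_m := invmx A *m sigma *m b.

Definition ou_mean : 'cV[R]_m :=
  ou_center + expmx (t *: - A) *m (x - ou_center).

(** The variance of <u, X_t>: the integral over [0, t] of |e^{-sA^T} u|^2, already diagonalized. *)
Definition ou_var (u : 'cV[R]_m) : R :=
  \sum_j dotcV (v j) u ^+ 2 * ((1 - expR (- phi j * t)) / phi j).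

Let W (u : 'cV[R]_m) (s : R) := expmx ((t - s) *: - A^T) *m u.

Lemma weight_norm u s : dotcV (sigma^T *m W u s) (sigma^T *m W u s) =
  \sum_j dotcV (v j) u ^+ 2 * expR (- phi j * (t - s)).
Proof.
rewrite dotcV_mull trmxK mulmxA hsigma mul1mx.
rewrite (@expmx_dot _ _ v ov A^T phi).
- by apply: eq_bigr => j _; rewrite expr2; ring.
- by rewrite trmxK normalA.
- by move=> j; rewrite trmxK addrC eigA.
Qed.

(** The variances of the weighted increments add up to a Riemann sum of the integral behind
    [ou_var]. *)
Lemma cvg_weights u :
  (fun N => \sum_(0 <= i < N.+1) (t / N.+1%:R) *
     dotcV (sigma^T *m W u (grid t N i)) (sigma^T *m W u (grid t N i)))
  @ \oo --> ou_var u.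
Proof.
rewrite (_ : (fun N => _) = fun N => \sum_j dotcV (v j) u ^+ 2 *
    \sum_(0 <= i < N.+1) expR (- phi j * (t - grid t N i)) * (t / N.+1%:R)).
  apply: cvg_sumr => j; apply: cvgM; first exact: cvg_cst.
  by apply: cvg_riemann_sum_expR; rewrite // gt_eqF.
apply/funext => N; under eq_bigr do rewrite weight_norm mulr_sumr.
rewrite exchange_big/=; apply: eq_bigr => j _; rewrite mulr_sumr.
by apply: eq_bigr => i _; ring.
Qed.

Lemma is_derive_weight u k (s : R) :
  is_derive s 1 (fun s => W u s k ord0) ((A^T *m W u s) k ord0).
Proof.
have h := is_derive_expmx_vec (- A^T) u k (t - s).
have hs : is_derive s 1 (fun s : R => t - s) (- 1).
  by apply: is_derive_eq; rewrite add0r mul1r.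
have := @is_derive1_comp R _ (fun s => t - s) s _ _ h hs.
rewrite /comp => hc; apply: is_derive_eq.
by rewrite mulrN1 mulNmx mulNmx mxE opprK mulmxA.
Qed.

Lemma ou_path u : {ae P, forall w,
  (fun N => \sum_(0 <= i < N.+1) dotcV (sigma^T *m W u (grid t N i))
      (B (grid t N i.+1) w - B (grid t N i) w)) @ \oo -->
    dotcV u (X t w) - dotcV u ou_mean}.
Proof.
apply: filterS hX => w [cX XE].
have uA : A \in unitmx by exact: (symmetric_part_unitmx ov eigA phi0).
have Aa : A *m ou_center = sigma *m b by rewrite /ou_center -mulmxA mulKVmx.
(* Recentring absorbs the drift sigma b: [D] solves the homogeneous equation driven by sigma (B -
   B_0) alone, as [cvg_stieltjes_sum] requires. *)
pose D s := X s w - ou_center.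
pose beta s := sigma *m (B s w - B 0 w).
have cXk k s : {within `[0, s], continuous (fun r => X r w k ord0)}.
  have cX' : {within `[0, s], continuous (fun r => X r w)}.
    have := cX; apply: continuous_subspaceW => y /=.
    by rewrite !in_itv/= andbT => /andP[].
  apply/subspace_continuousP => y ys.
  have /subspace_continuousP/(_ y ys) hy := cX'.
  exact: (@cvg_comp _ _ _ _ (fun M : 'cV[R]_m => M k ord0) _ _ _ hy
    (@coord_continuous R m 1 k ord0 (X y w))).
have cD k s : {within `[0, s], continuous (fun r => D r k ord0)}.
  rewrite (_ : (fun r => _) = fun r => X r w k ord0 - ou_center k ord0); last first.
    by apply/funext => r; rewrite !mxE.
  by move=> y; apply: cvgB; [exact: cXk|exact: cvg_cst].
have DE s : 0 <= s -> s <= t -> D s = (x - ou_center)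
  - (\col_i \int[leb]_(r in `[0, s]) (A *m D r) i ord0) + beta s.
  move=> s0 st; rewrite /D XE// /beta.
  have -> : sigma *m (B s w + s *: b - (B 0 w + 0 *: b)) =
      sigma *m (B s w - B 0 w) + s *: (sigma *m b).
    by rewrite scale0r addr0 addrAC mulmxDr -scalemxAr.
  have -> : \col_i \int[leb]_(r in `[0, s]) (A *m X r w) i ord0 =
      \col_i \int[leb]_(r in `[0, s]) (A *m (X r w - ou_center)) i ord0 +
      s *: (sigma *m b).
    apply/colP => i; rewrite [LHS]mxE [RHS]mxE [X in _ = X + _]mxE [X in _ = _ + X]mxE.
    have iAD k : leb.-integrable `[0, s] (EFin \o (fun r => A i k * D r k ord0)).
      rewrite [X in _.-integrable _ X](_ : _ = (fun r => (A i k)%:E * (D r k ord0)%:E)%E)//.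
      apply: integrableZl => //; apply: continuous_compact_integrable.
        exact: segment_compact.
      exact: cD.
    have [//|iAD' _] := @Rintegral_sumr _ _ (measurableTypeR R) leb `[0, s]%classic _
      (index_enum 'I_m) (fun k r => A i k * D r k ord0) _ iAD.
    have icst (q : R) : leb.-integrable `[0, s] (EFin \o (fun=> q)).
      apply: continuous_compact_integrable; first exact: segment_compact.
      by apply: continuous_subspaceT => y; exact: cvg_cst.
    transitivity (\int[leb]_(r in `[0, s])
        (\sum_k A i k * D r k ord0 + (sigma *m b) i ord0)).
      apply: eq_Rintegral => r _; rewrite -Aa /D.
      by rewrite -[X in (A *m X) i ord0](subrK ou_center) mulmxDr !mxE.
    rewrite RintegralD// Rintegral_cst// fine_lebesgue_itv0// [in RHS]mulrC.
    by congr (_ + _); apply: eq_Rintegral => r _; rewrite mxE.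
  move: (\col_i _) (sigma *m _) (s *: _) => C1 C2 C3.
  by apply/colP => i; rewrite !mxE; ring.
have D0 : D 0 = x - ou_center.
  rewrite DE// /beta subrr mulmx0 addr0.
  rewrite (_ : \col_i _ = 0) ?subr0//.
  by apply/colP => i; rewrite !mxE set_itv1 Rintegral_set1.
have := cvg_stieltjes_sum t0 (fun k => cD k t) DE (is_derive_weight u).
(* The weight ends at W_t = u and starts at W_0 = e^{-tA^T} u, whose transpose carries D_0 to the
   mean of D_t. *)
have -> : dotcV (W u t) (D t) - dotcV (W u 0) (D 0) = dotcV u (X t w) - dotcV u ou_mean.
  rewrite D0 /W subrr expmx0 mul1mx subr0 -[expmx (t *: - A^T)]trmxK expmx_tr raddfN/= trmxK.
  by rewrite dotcV_mull trmxK /D /ou_mean dotcVBr dotcVDr; ring.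
apply: cvg_trans; apply: near_eq_cvg; apply: nearW => N.
apply: eq_bigr => i _; rewrite /beta -mulmxBr dotcV_mull trmxK.
by congr (dotcV _ (_ *m _)); apply/colP => k; rewrite !mxE; ring.
Qed.

(** The limit of E cos (S_N + c') is computed twice: by dominated convergence along the paths, and
    from independence, where only the total variance of the weights survives. *)
Lemma ou_cos u c : \int[P]_w cos (dotcV u (X t w) + c) =
  normal_char (ou_var u) * cos (dotcV u ou_mean + c).
Proof.
pose S N w := \sum_(0 <= i < N.+1) dotcV (sigma^T *m W u (grid t N i))
      (B (grid t N i.+1) w - B (grid t N i) w).
pose c' := dotcV u ou_mean + c.
have mX : measurable_fun setT (fun w => dotcV u (X t w)).
  by apply: (measurableT_comp (measurable_dotcV u)).
have mS N : measurable_fun setT (S N).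
  apply: measurable_sum => i.
  by apply: (measurableT_comp (measurable_dotcV _)); exact: measurable_increment.
have h1 : (fun N => \int[P]_w cos (S N w + c')) @ \oo -->
    \int[P]_w cos (dotcV u (X t w) + c).
  apply: (@Rintegral_bounded_cvg _ _ _ P _ _ 1).
  - by move=> N; have [] := bounded_mfun_cos (measurable_funD (mS N) (measurable_cst c')).
  - by have [] := bounded_mfun_cos (measurable_funD mX (measurable_cst c)).
  - by move=> N w; rewrite ler_norml cos_geN1 cos_le1.
  - apply: filterS (ou_path u) => w hw.
    apply: continuous_cvg; first exact: continuous_cos.
    rewrite (_ : _ + c = (dotcV u (X t w) - dotcV u ou_mean) + c'); last by rewrite /c'; ring.
    by apply: cvgD; [exact: hw|exact: cvg_cst].
have h2 : (fun N => \int[P]_w cos (S N w + c')) @ \oo --> normal_char (ou_var u) * cos c'.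
  rewrite (_ : (fun N => _) = fun N => normal_char (\sum_(0 <= i < N.+1) (t / N.+1%:R) *
     dotcV (sigma^T *m W u (grid t N i)) (sigma^T *m W u (grid t N i))) * cos c').
    by apply: cvgM; [apply: cvg_normal_char; exact: cvg_weights|exact: cvg_cst].
  apply/funext => N.
  rewrite /S (increments_cos N.+1 (fun i => sigma^T *m W u (grid t N i)) c' (s := grid t N)).
  - under eq_bigr do rewrite gridS.
    by rewrite (normal_char_sum N.+1 (fun i => sigma^T *m W u (grid t N i)))// divr_ge0.
  - by rewrite grid0.
  - by move=> i j; exact: grid_homo.
by rewrite -(cvg_lim _ h1)// -(cvg_lim _ h2).
Qed.

End ornstein_uhlenbeck.

(** * Optimal transport between Gaussians with commuting covariances *)

Lemma integrable_le_ge0_integral {R : realType} {d : measure_display}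
    {T : measurableType d} (mu : {measure set T -> \bar R}) (L F : T -> R) :
  measurable_fun setT F -> (forall x, 0 <= F x) -> mu.-integrable setT (EFin \o L) ->
  (forall x, L x <= F x) ->
  ((\int[mu]_x L x)%:E <= \int[mu]_x (F x)%:E)%E.
Proof.
move=> mF F0 iL LF; rewrite /Rintegral fineK; last exact: integrable_fin_num.
(* F may have infinite integral, so L and F are not subtracted; the positive part of L lies between
   them because F >= 0. *)
apply: (@le_trans _ _ (\int[mu]_x ((EFin \o L)^\+ x))%E).
  apply: le_integral => //; first exact: integrable_funepos.
  by move=> x _; rewrite funeposE/= le_max lexx.
apply: ge0_le_integral => //.
- by apply: measurable_funepos; have /integrableP[] := iL.
- exact/measurable_EFinP.
- by move=> x _; rewrite funeposE/= ge_max !lee_fin LF F0.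
Qed.

Section gaussian_transport.
Context {R : realType} {m : nat}.
Variables (v : 'I_m -> 'cV[R]_m) (phi tau : 'I_m -> R) (a e : 'cV[R]_m).
Variables (mu nu : probability 'cV[R]_m R).
Hypothesis ov : orthonormal_family v.
Hypothesis phi0 : forall j, 0 < phi j.
Hypothesis tau0 : forall j, 0 <= tau j.
Hypothesis mu_law : normal_law mu a (spectral_mx v (fun j => (phi j)^-1)).

Let mid : measurable_fun setT (id : 'cV[R]_m -> 'cV[R]_m) :=
  @measurable_id _ _ setT.

Let id_law : normal_law (pushforward mu id) a (spectral_mx v (fun j => (phi j)^-1)) :=
  mu_law.

Definition transport (z : 'cV[R]_m) : 'cV[R]_m := e + spectral_mx v tau *m (z - a).

Lemma dotcV_transport u z : dotcV u (transport z) =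
  dotcV (spectral_mx v tau *m u) z + (dotcV u e - dotcV (spectral_mx v tau *m u) a).
Proof.
rewrite /transport dotcVDr -[spectral_mx v tau in LHS]tr_spectral_mx -dotcV_mull.
by rewrite dotcVBr; ring.
Qed.

Lemma measurable_transport : measurable_fun setT transport.
Proof.
apply: measurable_vec => i.
rewrite (_ : (fun z => _) = fun z => dotcV (spectral_mx v tau *m delta_mx i ord0) z +
  (dotcV (delta_mx i ord0) e - dotcV (spectral_mx v tau *m delta_mx i ord0) a)).
  by apply: measurable_funD => //; exact: measurable_dotcV.
by apply/funext => z; rewrite -dotcV_transport dotcV_delta.
Qed.

Lemma transport_cos u c : \int[mu]_z cos (dotcV u (transport z) + c) =
  normal_char (\sum_j dotcV (v j) u ^+ 2 * (tau j ^+ 2 / phi j)) * cos (dotcV u e + c).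
Proof.
under eq_Rintegral do rewrite dotcV_transport -addrA.
rewrite (@normal_law_cos _ _ _ _ mu id a _ mid id_law).
congr (normal_char _ * cos _); last by ring.
rewrite dotcV_spectral_mx; apply: eq_bigr => j _.
rewrite !(dotcVC (v j) (_ *m _)) dotcV_mull tr_spectral_mx spectral_mxE// dotcVZr.
by rewrite (dotcVC u); field; rewrite gt_eqF.
Qed.

Hypothesis nu_law : forall E, measurable E -> nu E = mu (transport @^-1` E).

(** Coordinates along v_j centred under the first marginal; [Z] does the same for the second, and
    [D] is the shift of the means. *)
Let Y j (z : 'cV[R]_m) := dotcV (v j) z - dotcV (v j) e.
Let Z j (z : 'cV[R]_m) := dotcV (v j) z - dotcV (v j) a.
Let D j := dotcV (v j) (e - a).

Let YE j z : Y j (transport z) = tau j * Z j z.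
Proof. by rewrite /Y /Z dotcV_transport spectral_mxE// !dotcVZl; ring. Qed.

Let mY j : measurable_fun setT (Y j).
Proof. by apply: measurable_funB => //; exact: measurable_dotcV. Qed.

Let mZ j : measurable_fun setT (Z j).
Proof. by apply: measurable_funB => //; exact: measurable_dotcV. Qed.

Let Zmean j : \int[mu]_z Z j z = 0.
Proof. exact: (@normal_law_mean _ _ _ _ mu id a _ mid id_law). Qed.

Let Zsqr j : \int[mu]_z Z j z ^+ 2 = (phi j)^-1.
Proof.
rewrite [LHS](@normal_law_sqr _ _ _ _ mu id a _ mid id_law).
by rewrite spectral_mxE// dotcVZr ov eqxx mulr1.
Qed.

Let iZ j : mu.-integrable setT (EFin \o Z j).
Proof. exact: (@normal_law_integrable _ _ _ _ mu id a _ mid id_law). Qed.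

Let iZ2 j : mu.-integrable setT (EFin \o (fun z => Z j z ^+ 2)).
Proof. exact: (@normal_law_integrable_sqr _ _ _ _ mu id a _ mid id_law). Qed.

(** Squared distance of the means plus squared differences of the standard deviations tau_j / sqrt
    phi_j and 1 / sqrt phi_j. *)
Definition transport_cost : R :=
  \sum_j D j ^+ 2 + \sum_j (phi j)^-1 * (1 - tau j) ^+ 2.

Lemma enorm_sqr (z : 'cV[R]_m * 'cV[R]_m) :
  enorm (z.1 - z.2) ^+ 2 = \sum_j (D j + Y j z.1 - Z j z.2) ^+ 2.
Proof.
rewrite /enorm sqr_sqrtr ?dotcV_ge0// (parseval ov); apply: eq_bigr => j _.
rewrite -expr2; congr (_ ^+ 2).
by rewrite /D /Y /Z !dotcVBr; ring.
Qed.

(** Serves both bounds: the minorants of the cost on each marginal, and the exact cost of the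
    transport coupling. *)
Lemma Rintegral_quadratic d (T : measurableType d) (P : probability T R)
    (c0 c1 c2 q : 'I_m -> R) (U : 'I_m -> T -> R) :
  (forall j, P.-integrable setT (EFin \o U j)) ->
  (forall j, P.-integrable setT (EFin \o (fun z => U j z ^+ 2))) ->
  (forall j, \int[P]_z U j z = 0) -> (forall j, \int[P]_z U j z ^+ 2 = q j) ->
  P.-integrable setT (EFin \o (fun z => \sum_j (c0 j + c1 j * U j z + c2 j * U j z ^+ 2))) /\
  \int[P]_z (\sum_j (c0 j + c1 j * U j z + c2 j * U j z ^+ 2)) =
    \sum_j (c0 j + c2 j * q j).
Proof.
move=> iU iU2 U0 Uq.
have ic j : P.-integrable setT (EFin \o (fun=> c0 j)).
  by apply: bounded_mfun_integrable; exact: bounded_mfun_cst.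
have iZl (k : R) f : P.-integrable setT (EFin \o f) ->
    P.-integrable setT (EFin \o (fun z => k * f z)).
  move=> intf; rewrite [X in _.-integrable _ X](_ : _ = (fun z => k%:E * (f z)%:E)%E)//.
  exact: integrableZl.
have iDD f g : P.-integrable setT (EFin \o f) -> P.-integrable setT (EFin \o g) ->
    P.-integrable setT (EFin \o (fun z => f z + g z)).
  move=> intf intg.
  rewrite [X in _.-integrable _ X](_ : _ = (fun z => (f z)%:E + (g z)%:E)%E)//.
  exact: (integrableD measurableT intf intg).
have i01 j := iDD _ _ (ic j) (iZl (c1 j) _ (iU j)).
have i2 j := iZl (c2 j) _ (iU2 j).
have [//|i ->] := @Rintegral_sumr R _ T P setT _ (index_enum 'I_m)
  (fun j z => c0 j + c1 j * U j z + c2 j * U j z ^+ 2) _ (fun j => iDD _ _ (i01 j) (i2 j)).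
split => //; apply: eq_bigr => j _.
rewrite RintegralD// RintegralD//; last exact: iZl.
by rewrite !RintegralZl// U0 Uq mulr0 addr0 Rintegral_cst// [X in fine X]probability_setT mulr1.
Qed.

Lemma measurable_enorm_sqr :
  measurable_fun setT (fun z : 'cV[R]_m * 'cV[R]_m => enorm (z.1 - z.2) ^+ 2).
Proof.
rewrite (_ : (fun _ => _) = fun z => \sum_j (D j + Y j z.1 - Z j z.2) ^+ 2); last first.
  by apply/funext => z; rewrite enorm_sqr.
apply: measurable_sum => j; apply: measurable_funX; apply: measurable_funB.
  by apply: measurable_funD => //; exact: measurableT_comp (mY j) measurable_fst.
exact: measurableT_comp (mZ j) measurable_snd.
Qed.

(** Duality: the cost dominates a function of z.1 plus a function of z.2, whose integral is fixed by
    the marginals whatever the coupling. *)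
Lemma coupling_cost_ge pi : coupling nu mu pi ->
  (transport_cost%:E <= \int[pi]_z ((enorm (z.1 - z.2) ^+ 2)%R)%:E)%E.
Proof.
move=> cpi; apply/lee_addgt0Pr => r r0.
pose K := \sum_j (phi j)^-1.
have K0 : 0 <= K by apply: sumr_ge0 => j _; rewrite invr_ge0 ltW.
(* Replacing tau_j by tau_j + q loses at most q / phi_j in direction j, because tau^2 / (tau + q) <=
   tau. In total the loss is at most q K <= r. *)
pose q := r / (K + 1).
have q0 : 0 < q by rewrite divr_gt0// ltr_wpDl.
have s0 j : 0 < tau j + q by rewrite ltr_wpDl.
have law1 E : measurable E -> pi (fst @^-1` E) = mu (transport @^-1` E).
  by move=> mE; have [-> _] := cpi _ mE; exact: nu_law.
have law2 E : measurable E -> pi (snd @^-1` E) = mu (id @^-1` E).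
  by move=> mE; have [_ ->] := cpi _ mE.
have tr1 (f : 'cV[R]_m -> R) := @eq_law_Rintegral _ _ _ _ _ _ _ pi mu fst transport
  measurable_fst measurable_transport law1 f.
have tr2 (f : 'cV[R]_m -> R) := @eq_law_Rintegral _ _ _ _ _ _ _ pi mu snd id
  measurable_snd mid law2 f.
have ti1 (f : 'cV[R]_m -> R) := @eq_law_integrable _ _ _ _ _ _ _ pi mu fst transport
  measurable_fst measurable_transport law1 f.
have ti2 (f : 'cV[R]_m -> R) := @eq_law_integrable _ _ _ _ _ _ _ pi mu snd id
  measurable_snd mid law2 f.
have mY2 j : measurable_fun setT (fun z => Y j z ^+ 2) by exact: measurable_funX.
have mZ2 j : measurable_fun setT (fun z => Z j z ^+ 2) by exact: measurable_funX.
have iY1 j : pi.-integrable setT (EFin \o (fun z => Y j z.1)).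
  apply: (ti1 (Y j)) => //.
  rewrite [X in _.-integrable _ X](_ : _ = (fun z => (tau j)%:E * (Z j z)%:E)%E).
    by apply: integrableZl => //; exact: iZ.
  by apply/funext => z; rewrite /= YE.
have iY2 j : pi.-integrable setT (EFin \o (fun z => Y j z.1 ^+ 2)).
  apply: (ti1 (fun z => Y j z ^+ 2)) => //.
  rewrite [X in _.-integrable _ X](_ : _ = (fun z => (tau j ^+ 2)%:E * (Z j z ^+ 2)%:E)%E).
    by apply: integrableZl => //; exact: iZ2.
  by apply/funext => z; rewrite /= YE exprMn.
have iZ1 j : pi.-integrable setT (EFin \o (fun z => Z j z.2)) by apply: (ti2 (Z j)) => //; exact: iZ.
have iZ22 j : pi.-integrable setT (EFin \o (fun z => Z j z.2 ^+ 2)).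
  by apply: (ti2 (fun z => Z j z ^+ 2)) => //; exact: iZ2.
have YI j : \int[pi]_z Y j z.1 = 0.
  rewrite (tr1 (Y j))//; under eq_Rintegral do rewrite YE.
  by rewrite RintegralZl// Zmean mulr0.
have YI2 j : \int[pi]_z Y j z.1 ^+ 2 = tau j ^+ 2 / phi j.
  rewrite (tr1 (fun z => Y j z ^+ 2))//; under eq_Rintegral do rewrite YE exprMn.
  by rewrite RintegralZl// Zsqr.
have ZI j : \int[pi]_z Z j z.2 = 0 by rewrite (tr2 (Z j)).
have ZI2 j : \int[pi]_z Z j z.2 ^+ 2 = (phi j)^-1.
  by rewrite (tr2 (fun z => Z j z ^+ 2)).
(* In (D + Y - Z)^2 the terms D^2 and 2 D Y go to the first potential and - 2 D Z to the second;
   only (Y - Z)^2 has to be bounded. *)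
have [iA EA] := Rintegral_quadratic (fun j => D j ^+ 2) (fun j => 2 * D j)
  (fun j => 1 - (tau j + q)^-1) iY1 iY2 YI YI2.
have [iB EB] := Rintegral_quadratic (fun j => 0) (fun j => - (2 * D j))
  (fun j => 1 - (tau j + q)) iZ1 iZ22 ZI ZI2.
set LA := fun z => _ in iA; set LB := fun z => _ in iB.
have iL : pi.-integrable setT (EFin \o (fun z => LA z + LB z)).
  rewrite [X in _.-integrable _ X](_ : _ = (fun z => (LA z)%:E + (LB z)%:E)%E)//.
  exact: (integrableD measurableT iA iB).
have lower z : LA z + LB z <= enorm (z.1 - z.2) ^+ 2.
  rewrite enorm_sqr /LA /LB -big_split/=; apply: ler_sum => j _.
  move: (D j) (Y j z.1) (Z j z.2) => D' Y' Z'.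
  (* (s^{-1/2} y - s^{1/2} z)^2 >= 0 with s = tau + q *)
  rewrite -subr_ge0.
  rewrite (_ : _ - _ = (tau j + q)^-1 * (Y' - (tau j + q) * Z') ^+ 2).
    by rewrite mulr_ge0 ?sqr_ge0// invr_ge0 ltW.
  by field; rewrite gt_eqF.
have := integrable_le_ge0_integral measurable_enorm_sqr (fun z => sqr_ge0 _) iL lower.
rewrite RintegralD// EA EB => h.
rewrite -leeBlDr//; apply: le_trans h; rewrite -EFinB lee_fin.
have -> : transport_cost - r = \sum_j D j ^+ 2 + \sum_j (phi j)^-1 * (1 - tau j) ^+ 2 - r by [].
rewrite -!big_split/=.
have -> : r = q * (K + 1) by rewrite /q divfK// gt_eqF// ltr_wpDl.
apply: (@le_trans _ _ (\sum_j (D j ^+ 2 + (phi j)^-1 * (1 - tau j) ^+ 2) - q * K)).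
  by rewrite lerD2l lerN2 ler_pM2l// lerDl.
rewrite /K mulr_sumr -sumrB; apply: ler_sum => j _.
have p0 : 0 <= (phi j)^-1 by rewrite invr_ge0 ltW.
rewrite -subr_ge0.
rewrite (_ : _ - _ = (phi j)^-1 * (tau j - tau j ^+ 2 / (tau j + q))); last by ring.
rewrite mulr_ge0// subr_ge0 ler_pdivrMr// expr2 ler_wpM2l// lerDl ltW//.
Qed.

(** The image of [mu] under z -> (T z, z). On it D + Y - Z = D + (tau - 1) Z, so the cost is
    quadratic in Z alone. *)
Lemma transport_coupling : exists2 pi, coupling nu mu pi &
  (\int[pi]_z ((enorm (z.1 - z.2) ^+ 2)%R)%:E = transport_cost%:E)%E.
Proof.
pose g (z : 'cV[R]_m) := (transport z, z).
have mg : measurable_fun setT g.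
  by apply: measurable_fun_pair => //; exact: measurable_transport.
pose gm := isMeasurableFun.Build _ _ _ _ _ mg.
pose gf : {mfun 'cV[R]_m >-> ('cV[R]_m * 'cV[R]_m)%type} := HB.pack g gm.
pose pi : probability _ R := distribution mu gf.
exists pi.
  by move=> E mE; split; rewrite ?nu_law.
have piE F : measurable F -> pi F = mu (g @^-1` F) by [].
rewrite (law_ge0_integral mg piE); first last.
- by move=> z; rewrite lee_fin sqr_ge0.
- apply/measurable_EFinP; exact: measurable_enorm_sqr.
have [i E] := Rintegral_quadratic (fun j => D j ^+ 2) (fun j => 2 * D j * (tau j - 1))
  (fun j => (tau j - 1) ^+ 2) iZ iZ2 Zmean Zsqr.
transitivity (\int[mu]_z (\sum_j (D j ^+ 2 + 2 * D j * (tau j - 1) * Z j z +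
    (tau j - 1) ^+ 2 * Z j z ^+ 2))%:E)%E.
  apply: eq_integral => z _; congr EFin; rewrite enorm_sqr; apply: eq_bigr => j _.
  by rewrite /g /= YE; ring.
rewrite -[LHS]fineK; last exact: integrable_fin_num.
congr EFin; rewrite -[LHS]/(Rintegral _ _ _) E /transport_cost -big_split/=.
by apply: eq_bigr => j _; ring.
Qed.

Lemma wasserstein2_transport : wasserstein2 nu mu = (Num.sqrt transport_cost)%:E.
Proof.
have c0 : 0 <= transport_cost.
  rewrite addr_ge0//; apply: sumr_ge0 => j _; first exact: sqr_ge0.
  by rewrite mulr_ge0 ?sqr_ge0// invr_ge0 ltW.
rewrite /wasserstein2 (_ : ereal_inf _ = transport_cost%:E).
  by rewrite poweR_EFin powR12_sqrt.
apply/eqP; rewrite eq_le; apply/andP; split.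
  have [pi cpi <-] := transport_coupling.
  by apply: ereal_inf_lbound; exists pi.
apply: le_ereal_inf_tmp => _ [pi /= cpi <-].
exact: coupling_cost_ge.
Qed.

End gaussian_transport.

(** * The distance to equilibrium *)

Lemma ou_wasserstein2 {R : realType} {m n : nat} (A : 'M[R]_m)
    (sigma : 'M[R]_(m, n)) (b : 'cV[R]_n)
    {d : measure_display} {Omega : measurableType d} (P : probability Omega R)
    (B : R -> {RV P >-> 'cV[R]_n}) (x : 'cV[R]_m) (X : R -> {RV P >-> 'cV[R]_m})
    (mu : probability 'cV[R]_m R) (phi : 'I_m -> R) (v : 'I_m -> 'cV[R]_m) (t : R) :
  sigma *m sigma^T = 1%:M -> brownian_motion B ->
  sde_solution A sigma (fun t w => B t w + t *: b) x X ->
  ((forall l : R[i], eigenvalue (cplxmx A) l -> 0 < complex.Re l) ->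
     normal_law mu (invmx A *m sigma *m b) (stationary_cov A sigma)) ->
  A *m A^T = A^T *m A -> (forall j, 0 < phi j) ->
  (forall j, (A + A^T) *m v j = phi j *: v j) -> orthonormal_family v -> 0 <= t ->
  wasserstein2 (distribution P (X t)) mu =
  (Num.sqrt
     (\sum_(j < m) expR (- phi j * t)
          * dotcV (x - invmx A *m sigma *m b) (v j) ^+ 2
      + \sum_(j < m) (phi j)^-1
          * (expR (- 2 * phi j * t)
             / (Num.sqrt (1 - expR (- phi j * t)) + 1) ^+ 2)))%:E.
Proof.
move=> hsigma hB hX hmu normalA phi0 eigA ov t0.
have mu_law := hmu (fun l => eigenvalue_Re_gt0 ov eigA phi0).
rewrite (stationary_covE ov normalA eigA phi0 hsigma) in mu_law.
pose tau j := Num.sqrt (1 - expR (- phi j * t)).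
have tau0 j : 0 <= tau j by exact: sqrtr_ge0.
have e1 j : 0 <= 1 - expR (- phi j * t).
  rewrite subr_ge0 -[leRHS]expR0 ler_expR mulNr oppr_le0.
  by rewrite mulr_ge0// ltW.
have tau2 j : tau j ^+ 2 = 1 - expR (- phi j * t) by rewrite sqr_sqrtr.
pose a := ou_center A sigma b; pose e := ou_mean A sigma b x t.
have mg := measurable_transport v tau a e.
pose gm := isMeasurableFun.Build _ _ _ _ _ mg.
pose gf : {mfun 'cV[R]_m >-> 'cV[R]_m} := HB.pack (transport v tau a e) gm.
pose rho : probability 'cV[R]_m R := distribution mu gf.
have nu_law E : measurable E -> distribution P (X t) E = mu (transport v tau a e @^-1` E).
  apply: (@cramer_wold R m (distribution P (X t)) rho) => u c.
  have mc : measurable_fun setT (fun z : 'cV[R]_m => cos (dotcV u z + c)).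
    by have [] := bounded_mfun_cos (measurable_dotcVD u c).
  rewrite (@law_Rintegral R _ _ _ _ P (X t) (distribution P (X t)) _ _ _ mc)//.
  rewrite (@law_Rintegral R _ _ _ _ mu _ rho mg _ _ mc)//.
  (* Both sides become [normal_char] of a variance times the same cosine; the variances agree since
     tau_j^2 = 1 - e^{-phi_j t}. *)
  rewrite (transport_cos tau e ov phi0 mu_law).
  rewrite (ou_cos hsigma hB ov normalA eigA phi0 hX t0 u c).
  congr (normal_char _ * _); apply: eq_bigr => j _.
  by rewrite tau2.
rewrite (wasserstein2_transport ov phi0 tau0 mu_law nu_law); congr (Num.sqrt (_ + _))%:E.
  transitivity (dotcV (e - a) (e - a)).
    by rewrite (parseval ov); apply: eq_bigr => j _; rewrite expr2.
  rewrite /e /ou_mean addrC addKr (expmx_dot ov normalA eigA).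
  by apply: eq_bigr => j _; rewrite -mulrA -expr2 (dotcVC (v j)).
apply: eq_bigr => j _; congr (_ * _).
(* Rationalization: multiplied by (tau_j + 1)^2, the factor (1 - tau_j)^2 becomes (1 - tau_j^2)^2 =
   e^{-2 phi_j t}. *)
have s1 : tau j + 1 != 0 by rewrite gt_eqF// ltr_wpDl.
apply: (mulIf (expf_neq0 2 s1)); rewrite divfK ?expf_neq0// -exprMn.
have -> : (1 - tau j) * (tau j + 1) = expR (- phi j * t).
  by rewrite -[RHS](subKr 1) -tau2; ring.
by rewrite -expRM_natl; congr expR; ring.
Qed.

Theorem theorem2p6 (R : realType) (m n : nat) (A : 'M[R]_m)
    (sigma : 'M[R]_(m, n)) (b : 'cV[R]_n)
    (d : measure_display) (Omega : measurableType d) (P : probability Omega R)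
    (B : R -> {RV P >-> 'cV[R]_n})
    (X : 'cV[R]_m -> R -> {RV P >-> 'cV[R]_m})
    (mu : probability 'cV[R]_m R)
    (hsigma : sigma *m sigma^T = 1%:M)
    (hB : brownian_motion B)
    (hX : forall x : 'cV[R]_m,
        sde_solution A sigma (fun t w => B t w + t *: b) x (X x))
    (hmu : (forall l : R[i], eigenvalue (cplxmx A) l -> 0 < complex.Re l) ->
        normal_law mu (invmx A *m sigma *m b) (stationary_cov A sigma)) :
  (forall (lam : 'I_m -> R) (v : 'I_m -> 'cV[R]_m),
      A^T = A -> posdefmx A ->
      (forall j, 0 < lam j) ->
      (forall i j : 'I_m, (i <= j)%N -> lam i <= lam j) ->
      (forall j, A *m v j = lam j *: v j) ->
      orthonormal_family v ->
      forall (x : 'cV[R]_m) (t : R), 0 <= t ->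
        wasserstein2 (distribution P (X x t)) mu =
        (Num.sqrt
           (\sum_(j < m) expR (- 2 * lam j * t)
                * dotcV (x - invmx A *m sigma *m b) (v j) ^+ 2
            + \sum_(j < m) (2 * lam j)^-1
                * (expR (- 4 * lam j * t)
                   / (Num.sqrt (1 - expR (- 2 * lam j * t)) + 1) ^+ 2)))%:E)
  /\
  (forall (phi : 'I_m -> R) (v : 'I_m -> 'cV[R]_m),
      A *m A^T = A^T *m A ->
      (forall j, 0 < phi j) ->
      (forall i j : 'I_m, (i <= j)%N -> phi i <= phi j) ->
      (forall j, (A + A^T) *m v j = phi j *: v j) ->
      orthonormal_family v ->
      (forall (x : 'cV[R]_m) (t : R), 0 <= t ->
        wasserstein2 (distribution P (X x t)) mu =
        (Num.sqrt
           (\sum_(j < m) expR (- phi j * t)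
                * dotcV (x - invmx A *m sigma *m b) (v j) ^+ 2
            + \sum_(j < m) (phi j)^-1
                * (expR (- 2 * phi j * t)
                   / (Num.sqrt (1 - expR (- phi j * t)) + 1) ^+ 2)))%:E)
      /\
      (forall l : 'I_m -> R[i], eigenvalues_of A l ->
        (forall i j : 'I_m, (i <= j)%N ->
           complex.Re (l i) <= complex.Re (l j)) ->
        forall j, phi j = 2 * complex.Re (l j))).
Proof.
split=> [lam v symA _ lam0 _ eigA ov x t t0|phi v normalA phi0 phi_le eigA ov].
  rewrite (@ou_wasserstein2 R m n A sigma b _ _ P B x (X x) mu (fun j => 2 * lam j) v t)//.
  - congr (Num.sqrt (_ + _))%:E; apply: eq_bigr => j _.
      by rewrite -mulNr.
    by rewrite -mulNr; congr (_ * (expR _ / _)); ring.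
  - by rewrite symA.
  - by move=> j; rewrite mulr_gt0.
  - by move=> j; rewrite symA mulmxDl eigA -scalerDl mulr_natl mulr2n.
split; first by move=> x t t0; exact: (ou_wasserstein2 hsigma hB).
by move=> l lA l_le j; exact: (eigenvalues_symmetric_partE ov eigA normalA lA phi_le l_le).
Qed.
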